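(* Let $n,m\ge1$, $\alpha\in\mathbb R$ and $u\in C_c^{2m}(\mathbb R^n\setminus\{0\})$. Then $$\|\Delta^m u\|_\alpha^2=H_{m-1,\alpha}\|u\|_{\alpha+4m}^2+\sum_{k=1}^m H_{k-2,\alpha}\Big[D_{\alpha+4k-4}\big\|T_{\alpha+4k-2}(\Delta^{m-k}u)\big\|_{\alpha+4k-2}^2+\big\|R_{\alpha+4k-4,1}(\Delta^{m-k}u)\big\|_{\alpha+4k-4}^2$$ $$+\big\|(\Delta-\Delta_r)(\Delta^{m-k}u)\big\|_{\alpha+4k-4}^2+2\sum_{j=1}^n\big\|T_{\alpha+4k-4}\big(L_j(\Delta^{m-k}u)\big)\big\|_{\alpha+4k-4}^2+2A_{\alpha+4k-4}\sum_{j=1}^n\big\|L_j(\Delta^{m-k}u)\big\|_{\alpha+4k-2}^2\Big],$$ where $H_{-1,\alpha}=1$ and $H_{k,\alpha}=\prod_{\ell=0}^{k}A_{\alpha+4\ell}^2$ for integers $k\ge0$.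
   Context: Let $n\ge1$ and write $r=|x|$ for $x\in\mathbb R^n$. For $\beta\in\mathbb R$ and $g$ continuous with compact support in $\mathbb R^n\setminus\{0\}$, set $\|g\|_\beta^2=\int_{\mathbb R^n}|g(x)|^2|x|^{-\beta}\,dx$. Let $\partial_r=\sum_{i=1}^n\frac{x_i}{r}\partial_{x_i}$, $\Delta_r=\partial_r^2+\frac{n-1}{r}\partial_r$ (radial Laplacian), $\Delta$ the usual Laplacian, and $L_j=\partial_{x_j}-\frac{x_j}{r}\partial_r$ for $1\le j\le n$. For $\alpha\in\mathbb R$, $T_\alpha f=\partial_r f+\frac{n-2-\alpha}{2r}f$, and $R_{\alpha,1}=T_\alpha\circ T_{\alpha+2}$. For $\beta\in\mathbb R$, $A_\beta=\frac{(n+\beta)(n-4-\beta)}{4}$ and $D_\beta=\frac{(n+\beta)^2+(n-4-\beta)^2}{4}$. *)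

(* Defs.v *)
From HB Require Import structures.
From mathcomp Require Import all_boot all_order all_algebra.
From mathcomp Require Import all_classical all_reals all_analysis.
Set Implicit Arguments. Unset Strict Implicit. Unset Printing Implicit Defensive.
Import Order.TTheory GRing.Theory Num.Theory.
Import numFieldNormedType.Exports.
Local Open Scope classical_set_scope.
Local Open Scope ring_scope.

Section Defs.
Variable R : realType.
Variable n : nat.

Notation V := 'rV[R]_n.

Definition evec (j : 'I_n) : V := \row_(i < n) (if i == j then 1 else 0).

Definition rad (x : V) : R := Num.sqrt (\sum_(i < n) x ord0 i ^+ 2).

Definition pd (j : 'I_n) (f : V -> R) : V -> R := fun x => derive f x (evec j).

Definition dr (f : V -> R) : V -> R :=
  fun x => \sum_(i < n) (x ord0 i / rad x) * pd i f x.

Definition Lap (f : V -> R) : V -> R := fun x => \sum_(i < n) pd i (pd i f) x.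

Definition Lapr (f : V -> R) : V -> R :=
  fun x => dr (dr f) x + (n%:R - 1) / rad x * dr f x.

Definition Lop (j : 'I_n) (f : V -> R) : V -> R :=
  fun x => pd j f x - x ord0 j / rad x * dr f x.

Definition Top (a : R) (f : V -> R) : V -> R :=
  fun x => dr f x + (n%:R - 2 - a) / (2 * rad x) * f x.

Definition Rop (a : R) (f : V -> R) : V -> R := Top a (Top (a + 2) f).

Definition Acoef (b : R) : R := (n%:R + b) * (n%:R - 4 - b) / 4.
Definition Dcoef (b : R) : R := ((n%:R + b) ^+ 2 + (n%:R - 4 - b) ^+ 2) / 4.

(* Hm1 k a = H_{k-1,a}:  Hm1 0 a = H_{-1,a} = 1,
   Hm1 (k+1) a = H_{k,a} = prod_{l=0}^{k} A_{a+4l}^2 *)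
Definition Hm1 (k : nat) (a : R) : R := \prod_(l < k) Acoef (a + 4 * l%:R) ^+ 2.

Fixpoint Ck (k : nat) (f : V -> R) : Prop :=
  match k with
  | 0 => forall x : V, x != 0 -> {for x, continuous f}
  | k'.+1 => (forall (x : V) (j : 'I_n), x != 0 -> derivable f x (evec j)) /\
             (forall j : 'I_n, Ck k' (pd j f))
  end.

Definition csupp_away0 (f : V -> R) : Prop :=
  compact (closure [set x | f x != 0]) /\ ~ closure [set x | f x != 0] (0 : V).

Fixpoint iint (k : nat) (F : seq R -> R) : \bar R :=
  match k with
  | 0 => (F [::])%:E
  | k'.+1 => (\int[@lebesgue_measure R]_t iint k' (fun s => F (t :: s)))%E
  end.

Definition vec_of (s : seq R) : V := \row_(i < n) nth 0 s i.

Definition wnorm2 (b : R) (g : V -> R) : R :=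
  fine (iint n (fun s => `|g (vec_of s)| ^+ 2 * powR (rad (vec_of s)) (- b))).

End Defs.

(* Main.v *)
Require Import Defs.
From HB Require Import structures.
From mathcomp Require Import all_boot all_order all_algebra.
From mathcomp Require Import all_classical all_reals all_analysis.
From mathcomp Require Import ring lra.
Set Implicit Arguments. Unset Strict Implicit. Unset Printing Implicit Defensive.
Import Order.TTheory GRing.Theory Num.Theory.
Import numFieldNormedType.Exports.
Local Open Scope classical_set_scope.
Local Open Scope ring_scope.

(* With r = |x|, let g = T_(a+2) f, h = T_a g and L_j = L_j f. The radial part
   satisfies Delta_r f = h + (a+2) g / r - A_a f / r^2; squaring against r^(-a),
   the mixed products are radial divergences up to a multiple of g^2, and
   D_a = (a+2)^2 + 2 A_a. The angular part is a divergence,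
   (Delta - Delta_r) f = sum_j d_j L_j, with (L_j)_j orthogonal to x, so the cross
   term with Delta_r f can be integrated by parts. Since f is only C^2, this uses
   the symmetric form int d_j F d_k G = int d_k F d_j G for F, G of class C^1,
   which follows from translation invariance applied to difference quotients.
   The resulting identity for one Laplacian, applied to Delta^(m-k) u with weight
   exponent alpha + 4k - 4 for k = 1, ..., m, telescopes. *)

(** * Iterated integrals of continuous compactly supported functions *)

(** Only linearity, a sup bound and translation invariance in each coordinate are used of the
    integral. They pass from one variable to the next because the inner integral of a uniformly
    continuous, compactly supported function is continuous in the outer variable. Both rules of
    integration by parts are limits of identities between difference quotients. The operator T_a is
    tuned to the weight: div (g^2 r^(-a-1) x/r) = 2 g (T_a g) r^(-a-1). The delicate product is
    (Delta - Delta_r) f times d_r^2 f, whose factors are merely continuous. It appears in sum_ij d_j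
    F_ij d_i G with F_ij = (x_i / r) r^(-a) L_j and G = d_r f, both of class C^1. After the swap,
    d_j G equals d_r L_j + L_j / r up to a multiple of x_j / r, to which L and d_r L are orthogonal.
    What remains is a quadratic form in d_r L_j and L_j / r; a radial divergence corrects its mixed
    term to that of (T_a L_j)^2, and the square left over has coefficient A_a. *)

Section OneDim.
Variable R : realType.
Notation mu := (@lebesgue_measure R).
Implicit Types (g : R -> R) (M : R).

Definition csupp1 M g := continuous g /\ forall t, M < `|t| -> g t = 0.

Lemma csupp1_restrict M g (a b : R) : csupp1 M g -> a <= - M -> M <= b ->
  (EFin \o g) = (EFin \o g) \_ `[a, b].
Proof.
move=> [_ g0] aM Mb; apply/funext => t; rewrite patchE; case: ifPn => //=.
move=> /negP; rewrite inE /= in_itv /= => /negP tab.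
rewrite g0 // ltNge; apply: contra tab; rewrite ler_norml => /andP[t1 t2].
by rewrite (le_trans aM t1) (le_trans t2 Mb).
Qed.

Lemma csupp1_integralE M g (a b : R) : csupp1 M g -> a <= - M -> M <= b ->
  (\int[mu]_t (g t)%:E = \int[mu]_(t in `[a, b]) (g t)%:E)%E.
Proof.
move=> cg aM Mb; rewrite [RHS]integral_mkcond.
by apply: eq_integral => t _; have := congr1 (fun F => F t) (csupp1_restrict cg aM Mb).
Qed.

Lemma csupp1_integrable_itv M g a b : csupp1 M g ->
  mu.-integrable `[a, b] (EFin \o g).
Proof.
move=> [cg _]; apply: continuous_compact_integrable; first exact: segment_compact.
exact: continuous_subspaceT.
Qed.

Lemma csupp1_integrable M g : csupp1 M g -> mu.-integrable setT (EFin \o g).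
Proof.
move=> cg; rewrite (csupp1_restrict cg (lexx _) (lexx _)).
rewrite -integrable_mkcond; last exact: measurable_itv.
exact: csupp1_integrable_itv cg.
Qed.

Lemma csupp1_integral_fin M g : csupp1 M g -> (\int[mu]_t (g t)%:E \is a fin_num)%E.
Proof. by move=> cg; apply: integrable_fin_num => //; exact: csupp1_integrable cg. Qed.

Lemma csupp1_integralD M g h : csupp1 M g -> csupp1 M h ->
  (\int[mu]_t (g t + h t)%:E = \int[mu]_t (g t)%:E + \int[mu]_t (h t)%:E)%E.
Proof.
move=> cg ch; under eq_integral do rewrite EFinD.
by rewrite integralD //; [exact: csupp1_integrable cg|exact: csupp1_integrable ch].
Qed.

Lemma csupp1_integralZ M g c : csupp1 M g ->
  (\int[mu]_t (c * g t)%:E = c%:E * \int[mu]_t (g t)%:E)%E.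
Proof.
move=> cg; under eq_integral do rewrite EFinM.
by rewrite integralZl //; exact: csupp1_integrable cg.
Qed.

Lemma csupp1_integral_le M g (e : R) : 0 <= M -> csupp1 M g ->
  (forall t, `|g t| <= e) -> `|fine (\int[mu]_t (g t)%:E)%E| <= 2 * M * e.
Proof.
move=> M0 cg ge; rewrite (csupp1_integralE cg (lexx _) (lexx _)).
have ig := csupp1_integrable_itv (- M) M cg.
have := @le_normr_Rintegral _ _ _ mu `[- M, M]%classic g.
rewrite /Rintegral => /(_ (measurable_itv _) ig) /le_trans; apply.
rewrite -lee_fin fineK; last first.
  by apply: integrable_fin_num => //; exact: (integrable_abse ig).
apply: (@le_trans _ _ (\int[mu]_(t in `[(- M)%R, M]) e%:E)%E).
  apply: le_integral => //; first exact: (integrable_abse ig).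
    by apply: continuous_compact_integrable; [exact: segment_compact|
      apply: continuous_subspaceT => x; exact: cst_continuous].
  by move=> t _; rewrite lee_fin.
rewrite integral_cst //= lebesgue_measure_itv /= lte_fin.
(* The measure formula tests [- M < M]; its other branch forces M = 0, where both sides vanish. *)
case: ifPn => [_|]; first by rewrite -EFinD -EFinM lee_fin opprK; lra.
rewrite -leNgt => MM; have -> : M = 0 by lra.
by rewrite mule0 mulr0 mul0r.
Qed.

Lemma csupp1_shift M g h : csupp1 M g -> csupp1 (M + `|h|) (fun t => g (t + h)).
Proof.
move=> [cg g0]; split.
  by move=> t; apply: continuous_comp; [apply: cvgD; [exact: cvg_id|exact: cvg_cst]|exact: cg].
move=> t Mt; apply: g0; rewrite -(ltrD2r `|h|); apply: (lt_le_trans Mt).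
by have := ler_normB (t + h) h; rewrite addrK.
Qed.

Lemma csupp1_integral_shift M g h : 0 <= M -> csupp1 M g ->
  (\int[mu]_t (g (t + h))%:E = \int[mu]_t (g t)%:E)%E.
Proof.
(* Substitution works on a bounded interval: [a, b] contains the support of the translate, and
   [a + h, b + h] contains that of [g]. *)
move=> M0 cg; pose a := - (M + `|h|); pose b := M + `|h|.
have h0 : 0 <= `|h| by [].
have hh : h <= `|h| by exact: ler_norm.
have nh : - h <= `|h| by rewrite -normrN ler_norm.
rewrite (@csupp1_integralE _ _ a b (csupp1_shift h cg)) //.
rewrite (@csupp1_integralE _ _ (a + h) (b + h) cg); [|by rewrite /a; lra|by rewrite /b; lra].
have D1 : (fun t : R => t + h)^`()%classic = cst 1.
  by apply/funext => t; rewrite derive1E derive_val addr0.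
rewrite (@integration_by_substitution_increasing R (fun t => t + h) g a b).
- by apply: eq_integral => t _ /=; rewrite D1 /= /GRing.mul /= mulr1.
- by rewrite /a /b; lra.
- by move=> x y _ _; rewrite ltrD2r.
- by rewrite D1 => x _; exact: cst_continuous.
- by rewrite D1; exact: is_cvg_cst.
- by rewrite D1; exact: is_cvg_cst.
- have cs : continuous (fun t : R => t + h).
    by move=> t; apply: cvgD; [exact: cvg_id|exact: cvg_cst].
  split.
  + by move=> x _; apply: derivableD; [exact: derivable_id|exact: derivable_cst].
  + by apply: cvg_at_right_filter; exact: cs.
  + by apply: cvg_at_left_filter; exact: cs.
- by apply: continuous_subspaceT; case: cg.
Qed.

End OneDim.

(** * Linearity, bound and translation invariance for iterated integrals *)

Section IteratedIntegral.
Variable R : realType.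
Implicit Types (F G : seq R -> R) (M : R) (k : nat).

(** Continuity is uniform, in the sup distance, so that all sections in the first variable share one
    modulus; this makes the integral over the remaining variables continuous in the first. *)
Definition ucsupp k M F :=
  (forall s, size s = k -> F s != 0 -> all (fun t => `|t| <= M) s) /\
  (forall e, 0 < e -> exists2 d, 0 < d & forall s t, size s = k -> size t = k ->
    (forall i, `|nth 0 s i - nth 0 t i| < d) -> `|F s - F t| <= e).

Lemma eq_iint k F G : (forall s, size s = k -> F s = G s) -> iint k F = iint k G.
Proof.
elim: k F G => [|k IH] F G FG /=; first by rewrite FG.
by apply: eq_integral => t _; apply: IH => s sk; apply: FG; rewrite /= sk.
Qed.

Lemma ucsupp_cons k M F (t : R) : ucsupp k.+1 M F -> ucsupp k M (fun s => F (t :: s)).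
Proof.
move=> [F1 F2]; split.
  by move=> s sk /F1; rewrite /= sk => /(_ erefl) /andP[].
move=> e e0; have [d d0 dF] := F2 e e0; exists d => // s s' sk sk' ss'.
apply: dF; rewrite /= ?sk ?sk' //; case=> [|i] //=.
by rewrite subrr normr0.
Qed.

Lemma ucsuppD k M F G : ucsupp k M F -> ucsupp k M G ->
  ucsupp k M (fun s => F s + G s).
Proof.
move=> [F1 F2] [G1 G2]; split.
  move=> s sk FG; have [Fs|/F1 -> //] := eqVneq (F s) 0.
  by apply: G1 => //; move: FG; rewrite Fs add0r.
move=> e e0; have e20 : 0 < e / 2 by lra.
have [d d0 dF] := F2 _ e20; have [d' d'0 dG] := G2 _ e20.
exists (Num.min d d'); first by rewrite lt_min d0.
have minl_le (x y : R) : Num.min x y <= x by rewrite ge_min lexx.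
have minr_le (x y : R) : Num.min x y <= y by rewrite ge_min lexx orbT.
move=> s t sk tk st.
have := dF s t sk tk (fun i => lt_le_trans (st i) (minl_le _ _)).
have := dG s t sk tk (fun i => lt_le_trans (st i) (minr_le _ _)).
have -> : F s + G s - (F t + G t) = (F s - F t) + (G s - G t) by ring.
by move=> h1 h2; apply: (le_trans (ler_normD _ _)); lra.
Qed.

Lemma ucsuppZ k M c F : ucsupp k M F -> ucsupp k M (fun s => c * F s).
Proof.
move=> [F1 F2]; split.
  by move=> s sk; rewrite mulf_eq0 negb_or => /andP[_ /F1]; exact.
move=> e e0; have c0 : 0 < `|c| + 1 by rewrite ltr_wpDl.
have [|d d0 dF] := F2 (e / (`|c| + 1)); first by rewrite divr_gt0.
exists d => // s t sk tk st; rewrite -mulrBr normrM.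
have := dF s t sk tk st; rewrite ler_pdivlMr //; apply: le_trans.
by rewrite mulrC ler_wpM2l // lerDl.
Qed.

(** These properties are bundled because the induction on the number of variables needs them
    together: continuity of the inner integral follows from additivity, scaling and the bound,
    applied to the difference of two sections. *)
Definition iint_wb k M :=
  [/\ forall F, ucsupp k M F -> iint k F \is a fin_num,
      forall F G, ucsupp k M F -> ucsupp k M G ->
        fine (iint k (fun s => F s + G s)) = fine (iint k F) + fine (iint k G),
      forall c F, ucsupp k M F ->
        fine (iint k (fun s => c * F s)) = c * fine (iint k F)
    & forall e F, ucsupp k M F -> 0 <= e -> (forall s, size s = k -> `|F s| <= e) ->
        `|fine (iint k F)| <= (2 * M) ^+ k * e].

Lemma iint_section_csupp1 k M F : 0 <= M -> iint_wb k M -> ucsupp k.+1 M F ->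
  csupp1 M (fun t => fine (iint k (fun s => F (t :: s)))).
Proof.
move=> M0 [fin add sca bnd] cF; set g := fun t => _; split; last first.
  move=> t Mt; apply/normr0_eq0/eqP; rewrite eq_le normr_ge0 andbT.
  (* Beyond M the section vanishes identically, so the bound applies with e = 0. *)
  have := bnd 0 _ (ucsupp_cons t cF) (lexx _); rewrite mulr0; apply=> s sk.
  rewrite normr_le0; apply: contraTT Mt => /(proj1 cF).
  by rewrite /= sk -leNgt => /(_ erefl) /andP[].
move=> t; apply/cvgrPdist_le => e e0.
(* The added 1 keeps the divisor positive when M = 0. *)
have C0 : 0 < (2 * M) ^+ k + 1 by rewrite ltr_wpDl // exprn_ge0 // mulr_ge0.
have [|d d0 dF] := (proj2 cF) (e / ((2 * M) ^+ k + 1)); first by rewrite divr_gt0.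
near=> t'.
have -> : g t - g t' = fine (iint k (fun s => F (t :: s) + (-1) * F (t' :: s))).
  rewrite add; [|exact: ucsupp_cons|exact/ucsuppZ/ucsupp_cons].
  by rewrite sca ?mulN1r //; exact: ucsupp_cons.
apply: (@le_trans _ _ ((2 * M) ^+ k * (e / ((2 * M) ^+ k + 1)))); last first.
  rewrite mulrCA ger_pMr // ler_pdivrMr // mul1r lerDl //.
apply: bnd; first by apply: ucsuppD; [|apply: ucsuppZ]; exact: ucsupp_cons.
  by rewrite divr_ge0 // ltW.
move=> s sk; rewrite mulN1r; apply: dF; rewrite /= ?sk //; case=> [|i] /=.
  by near: t'; exact: (@cvgr_dist_lt _ _ _ _ _ id).
by rewrite subrr normr0.
Unshelve. all: by end_near. Qed.

Lemma iint_wbP k M : 0 <= M -> iint_wb k M.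
Proof.
move=> M0; elim: k => [|k wb]; last have [fin add sca bnd] := wb.
  by split => //= e F _ e0 Fe; rewrite expr0 mul1r Fe.
pose g F t := fine (iint k (fun s => F (t :: s))).
have gE F t : ucsupp k.+1 M F -> iint k (fun s => F (t :: s)) = (g F t)%:E.
  by move=> cF; rewrite /g fineK //; apply: fin; exact: ucsupp_cons.
have cg F : ucsupp k.+1 M F -> csupp1 M (g F) by exact: iint_section_csupp1.
have IE F : ucsupp k.+1 M F -> (iint k.+1 F = \int[@lebesgue_measure R]_t (g F t)%:E)%E.
  by move=> cF; apply: eq_integral => t _; exact: gE.
split.
- by move=> F cF; rewrite IE //; exact: (csupp1_integral_fin (cg _ cF)).
- move=> F G cF cG; rewrite !IE //; last exact: ucsuppD.
  rewrite -fineD; try exact: (csupp1_integral_fin (cg _ _)).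
  rewrite -(csupp1_integralD (cg _ cF) (cg _ cG)); congr fine.
  apply: eq_integral => t _; congr (_%:E).
  by rewrite /g add //; exact: ucsupp_cons.
- move=> c F cF; rewrite !IE //; last exact: ucsuppZ.
  have -> : c * fine (\int[@lebesgue_measure R]_t (g F t)%:E)%E =
     fine (c%:E * \int[@lebesgue_measure R]_t (g F t)%:E)%E.
    by rewrite fineM //; exact: (csupp1_integral_fin (cg _ cF)).
  rewrite -(csupp1_integralZ _ (cg _ cF)); congr fine.
  apply: eq_integral => t _; congr (_%:E).
  by rewrite /g sca //; exact: ucsupp_cons.
- move=> e F cF e0 Fe; rewrite IE // exprS -mulrA.
  apply: csupp1_integral_le => //; first exact: cg.
  by move=> t; apply: bnd => //; [exact: ucsupp_cons|move=> s sk; apply: Fe; rewrite /= sk].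
Qed.

(** Variables before the j-th are merely carried along under their integrals, so the recursion ends
    at an outermost variable, where the one-dimensional result applies. The order of integration
    never changes. *)
Lemma iint_shift k M F j (h : R) : 0 <= M -> (j < k)%N -> ucsupp k M F ->
  iint k (fun s => F (set_nth 0 s j (nth 0 s j + h))) = iint k F.
Proof.
move=> M0; elim: k F j => [//|k IH] F [|j] jk cF /=; last first.
  by apply: eq_integral => t _; apply: (IH (fun s => F (t :: s))) => //; exact: ucsupp_cons.
have wb := iint_wbP k M0; have [fin _ _ _] := wb.
pose g t := fine (iint k (fun s => F (t :: s))).
have gE t : iint k (fun s => F (t :: s)) = (g t)%:E.
  by rewrite /g fineK //; apply: fin; exact: ucsupp_cons.
have cg : csupp1 M g by exact: iint_section_csupp1.
under eq_integral do rewrite gE.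
under [RHS]eq_integral do rewrite gE.
exact: csupp1_integral_shift cg.
Qed.

End IteratedIntegral.

Lemma eq0_small (R : realType) (x C : R) :
  (forall e, 0 < e -> `|x| <= C * e) -> x = 0.
Proof.
move=> xC; apply/normr0_eq0/eqP; rewrite eq_le normr_ge0 andbT.
apply/ler_addgt0Pl => e e0; rewrite addr0.
have C0 : 0 < `|C| + 1 by rewrite ltr_wpDl.
have := xC (e / (`|C| + 1)); rewrite divr_gt0 // => /(_ isT) /le_trans; apply.
by rewrite mulrCA ger_pMr // ler_pdivrMr // mul1r (le_trans (ler_norm _)) // lerDl.
Qed.

(** * Continuous functions of compact support on R^n *)

Section CompactSupport.
Variables (R : realType) (n : nat).
Notation V := 'rV[R]_n.
Notation evec := (@evec R n).
Implicit Types (f g : V -> R) (x y : V) (M h e : R) (j : 'I_n).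

Definition intRn g : R := fine (iint n (fun s => g (vec_of n s))).

Definition ccsupp M g := continuous g /\ forall x, M < `|x| -> g x = 0.

Lemma ler_coord_norm x j : `|x ord0 j| <= `|x|.
Proof.
rewrite [leRHS]/Num.norm /= mx_normrE.
exact: (le_bigmax _ (fun ij : 'I_1 * 'I_n => `|x ij.1 ij.2|) (ord0, j)).
Qed.

Lemma ltr_norm_coord x e : 0 < e -> (forall j, `|x ord0 j| < e) -> `|x| < e.
Proof.
move=> e0 xe; rewrite [ltLHS]/Num.norm /= mx_normrE.
by apply/bigmax_ltP; split => // -[i j] _ /=; rewrite ord1.
Qed.

Lemma norm_evec j : `|evec j| <= 1.
Proof.
rewrite [leLHS]/Num.norm /= mx_normrE; apply/bigmax_leP; split => // -[i k] _ /=.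
by rewrite mxE; case: ifP => _; rewrite ?normr1 ?normr0.
Qed.

Lemma norm_scale_evec h j : `|h *: evec j| <= `|h|.
Proof. by rewrite normrZ ler_piMr // norm_evec. Qed.

Lemma compact_normle M : compact [set x : V | `|x| <= M].
Proof.
apply: bounded_closed_compact.
  exists M; split; first exact: num_real.
  by move=> y My x /= xM; rewrite (le_trans xM) // ltW.
rewrite (_ : [set _ | _] = Num.norm @^-1` [set z | z <= M]) //.
by apply: closed_comp; [move=> x _; exact: norm_continuous|exact: closed_le].
Qed.

Lemma ccsupp_ucont M g : ccsupp M g -> forall e, 0 < e ->
  exists2 d, 0 < d & forall x y, `|x - y| < d -> `|g x - g y| <= e.
Proof.
move=> [cg g0] e e0.
pose P (d : R) (x : V) := forall y, `|x - y| < d -> `|g x - g y| <= e.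
(* Compactness as a near covering: a modulus d that works for all small d near each point of the
   ball works for all small d on the whole ball. *)
have /compact_near_coveringP/near_covering_withinP := @compact_normle (M + 1).
move=> /(_ R (0^'+) P _) H.
have [d [d0 Hd]] : exists d, 0 < d /\ forall x, `|x| <= M + 1 -> P d x.
  have {}H : \forall d \near 0^'+, [set x : V | `|x| <= M + 1] `<=` P d.
    apply: H => x xM.
    have e20 : 0 < e / 2 by lra.
    have /cvgrPdist_lt /(_ _ e20) /nbhs_normP[r /= r0 rx] := cg x.
    have r20 : 0 < r / 2 by lra.
    near=> x' d => /= x'M y x'y.
    have xx' : `|x - x'| < r / 2 by near: x'; exact: (@cvgr_dist_lt _ _ _ _ _ id).
    have dr : d < r / 2 by near: d; exact: nbhs_right_lt.
    have h1 : `|g x - g x'| < e / 2 by apply: rx => /=; lra.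
    have h2 : `|g x - g y| < e / 2.
      apply: rx => /=; rewrite -(subrKA x'); apply: (le_lt_trans (ler_normD _ _)); lra.
    rewrite -(subrKA (g x)); apply: (le_trans (ler_normD _ _)).
    by rewrite (distrC (g x')); lra.
  near (0 : R)^'+ => d; exists d; split; first by near: d; exact: nbhs_right_gt.
  move=> x xM; have : [set x : V | `|x| <= M + 1] `<=` P d by near: d.
  by apply.
(* With d at most 1, a point beyond radius M + 1 has only neighbours beyond M, where [g]
   vanishes. *)
exists (Num.min d 1); first by rewrite lt_min d0 ltr01.
move=> x y; rewrite lt_min => /andP[xyd xy1].
have [xM|xM] := leP `|x| (M + 1); first exact: Hd.
rewrite (g0 x) ?(g0 y) ?subrr ?normr0 ?(ltW e0) //; last by rewrite (le_lt_trans _ xM) // lerDl.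
by have := ler_normB (x - y) (- y); rewrite opprK subrK normrN; lra.
Unshelve. all: by end_near. Qed.

Lemma ccsupp_bounded M g : ccsupp M g -> exists2 B, 0 <= B & forall x, `|g x| <= B.
Proof.
move=> cg; have /compact_bounded [B [_ HB]] :=
  continuous_compact (continuous_subspaceT (proj1 cg)) (@compact_normle M).
exists (`|B| + 1) => // x; have [xM|xM] := leP `|x| M; last first.
  by rewrite (proj2 cg) // normr0.
apply: (HB (`|B| + 1)); last by exists x.
by rewrite (le_lt_trans (ler_norm _)) // ltrDl.
Qed.

Lemma ccsupp_le M M' g : M <= M' -> ccsupp M g -> ccsupp M' g.
Proof. by move=> MM' [cg g0]; split => // x /(le_lt_trans MM'); exact: g0. Qed.

Lemma ccsuppD M f g : ccsupp M f -> ccsupp M g -> ccsupp M (fun x => f x + g x).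
Proof.
move=> [cf f0] [cg g0]; split; first by move=> x; exact: (continuousD (cf x) (cg x)).
by move=> x Mx; rewrite f0 // g0 // addr0.
Qed.

Lemma ccsuppM M f g : continuous f -> ccsupp M g -> ccsupp M (fun x => f x * g x).
Proof.
move=> cf [cg g0]; split; first by move=> x; exact: (continuousM (cf x) (cg x)).
by move=> x Mx; rewrite g0 // mulr0.
Qed.

Lemma ccsuppZ M c g : ccsupp M g -> ccsupp M (fun x => c * g x).
Proof. by apply: ccsuppM => x; exact: cst_continuous. Qed.

Lemma ccsuppB M f g : ccsupp M f -> ccsupp M g -> ccsupp M (fun x => f x - g x).
Proof.
move=> cf cg; have := ccsuppD cf (ccsuppZ (-1) cg); congr ccsupp.
by apply/funext => x; rewrite mulN1r.
Qed.

Lemma ccsupp_shift M g j h : ccsupp M g ->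
  ccsupp (M + `|h|) (fun x => g (x + h *: evec j)).
Proof.
move=> [cg g0]; split.
  move=> x; apply: (@continuous_comp _ _ _ (fun x : V => x + h *: evec j) g); last exact: cg.
  by apply: (@continuousD _ _ _ id (cst _) x); [exact: cvg_id|exact: cst_continuous].
move=> x Mx; apply: g0; rewrite -(ltrD2r `|h|); apply: (lt_le_trans Mx).
have := ler_normB (x + h *: evec j) (h *: evec j); rewrite addrK => /le_trans; apply.
by rewrite lerD2l norm_scale_evec.
Qed.

Lemma ccsupp_ucsupp M g : ccsupp M g -> ucsupp n M (fun s => g (vec_of n s)).
Proof.
move=> cg; split.
  move=> s sn; apply: contraTT => /allPn[t ts]; rewrite -ltNge => Mt.
  move: (ts); rewrite -index_mem sn => it.
  rewrite negbK (proj2 cg) //; apply: (lt_le_trans Mt).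
  have := ler_coord_norm (vec_of n s) (Ordinal it); rewrite mxE /=.
  by rewrite nth_index.
move=> e e0; have [d d0 dg] := ccsupp_ucont cg e0; exists d => // s t _ _ st.
by apply: dg; apply: ltr_norm_coord => // j; rewrite !mxE.
Qed.

Lemma eq_intRn f g : f =1 g -> intRn f = intRn g.
Proof. by move=> /funext ->. Qed.

Lemma intRnD M f g : 0 <= M -> ccsupp M f -> ccsupp M g ->
  intRn (fun x => f x + g x) = intRn f + intRn g.
Proof.
by move=> M0 cf cg; have [_ + _ _] := iint_wbP n M0; apply; exact: ccsupp_ucsupp.
Qed.

Lemma intRnZ M c g : 0 <= M -> ccsupp M g -> intRn (fun x => c * g x) = c * intRn g.
Proof.
by move=> M0 cg; have [_ _ + _] := iint_wbP n M0; apply; exact: ccsupp_ucsupp.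
Qed.

Lemma intRn_le M g e : 0 <= M -> ccsupp M g -> (forall x, `|g x| <= e) ->
  `|intRn g| <= (2 * M) ^+ n * e.
Proof.
move=> M0 cg ge; have [_ _ _ +] := iint_wbP n M0; apply => //.
  exact: ccsupp_ucsupp.
by apply: le_trans (ge 0).
Qed.

Lemma intRn_shift M g j h : 0 <= M -> ccsupp M g ->
  intRn (fun x => g (x + h *: evec j)) = intRn g.
Proof.
move=> M0 cg; rewrite /intRn -(iint_shift h M0 (ltn_ord j) (ccsupp_ucsupp cg)).
congr fine; apply: eq_iint => s sn; congr g; apply/rowP => i.
rewrite !mxE nth_set_nth /=.
have -> : (nat_of_ord i == nat_of_ord j) = (i == j) by [].
by case: eqP => [->|_]; rewrite ?mulr1 // mulr0 addr0.
Qed.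

Lemma intRnB M f g : 0 <= M -> ccsupp M f -> ccsupp M g ->
  intRn (fun x => f x - g x) = intRn f - intRn g.
Proof.
move=> M0 cf cg; rewrite -mulN1r -(intRnZ _ M0 cg) -(intRnD M0 cf (ccsuppZ _ cg)).
by apply: eq_intRn => x; rewrite mulN1r.
Qed.

End CompactSupport.

(** * Integration by parts *)

Section Directional.
Variables (R : realType) (n : nat).
Notation V := 'rV[R]_n.
Notation evec := (@evec R n).
Notation intRn := (@intRn R n).
Implicit Types (f g : V -> R) (x y : V) (M h e : R) (i j k : 'I_n).

Lemma is_derive_line f x (v : V) (t : R) : derivable f (x + t *: v) v ->
  is_derive t 1 (fun s : R => f (x + s *: v)) ('D_v f (x + t *: v)).
Proof.
move=> df.
have E : (fun h : R => h^-1 *: (((fun s : R => f (x + s *: v)) \o shift t) (h *: 1)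
            - f (x + t *: v)))
       = (fun h : R => h^-1 *: ((f \o shift (x + t *: v)) (h *: v) - f (x + t *: v))).
  apply/funext => h /=; congr (_ *: (f _ - _)).
  by rewrite [h *: 1]mulr1 scalerDl addrCA.
apply: DeriveDef; first by rewrite /derivable E.
by rewrite /derive E.
Qed.

(** Locating the intermediate point only by [|c| <= |h|] lets one statement serve both signs of h.
    Derivability is asked near the segment alone, so that functions singular at the origin
    qualify. *)
Lemma MVT_line f x j h :
  (forall t : R, `|t| <= `|h| -> derivable f (x + t *: evec j) (evec j)) ->
  exists2 c, `|c| <= `|h| &
    f (x + h *: evec j) - f x = pd j f (x + c *: evec j) * h.
Proof.
move=> df; pose g (s : R) := f (x + s *: evec j).
pose dg (s : R) := pd j f (x + s *: evec j).
have dgP (t : R) : `|t| <= `|h| -> is_derive t 1 g (dg t) by move=> /df/is_derive_line.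
have cgP (t : R) : `|t| <= `|h| -> {for t, continuous g}.
  move=> /dgP [gt _]; apply: differentiable_continuous; exact/derivable1_diffP.
have fE : f x = g 0 by rewrite /g scale0r addr0.
have [h0|h0] := leP 0 h.
  have sub (t : R) : t \in `[0, h] -> `|t| <= `|h|.
    by rewrite in_itv /= => /andP[t0 th]; rewrite !ger0_norm.
  have [||c c0 Ec] := @MVT_segment R g dg 0 h h0.
  - by move=> t /subset_itv_oo_cc /sub /dgP.
  - apply: continuous_in_subspaceT => t; rewrite inE /= => /sub; exact: cgP.
  - exists c; first exact: sub.
    by rewrite fE Ec subr0.
have sub (t : R) : t \in `[h, 0] -> `|t| <= `|h|.
  by rewrite in_itv /= => /andP[t0 th]; rewrite !ler0_norm ?lerN2 // ltW.
have [||c c0 Ec] := @MVT_segment R g dg h 0 (ltW h0).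
- by move=> t /subset_itv_oo_cc /sub /dgP.
- apply: continuous_in_subspaceT => t; rewrite inE /= => /sub; exact: cgP.
- exists c; first exact: sub.
  by rewrite fE -[LHS]opprB Ec sub0r mulrN opprK.
Qed.

Definition C1csupp M f := [/\ ccsupp M f, forall x j, derivable f x (evec j)
  & forall j, ccsupp M (pd j f)].

Definition dquot j h f x := h^-1 * (f (x + h *: evec j) - f x).

Lemma ccsupp_dquot M f j h : `|h| <= 1 -> ccsupp M f -> ccsupp (M + 1) (dquot j h f).
Proof.
move=> h1 cf; apply: (@ccsuppZ _ _ _ h^-1 (fun x => f (x + h *: evec j) - f x)).
apply: ccsuppB.
  by apply: (ccsupp_le _ (ccsupp_shift j h cf)); rewrite lerD2l.
by apply: (ccsupp_le _ cf); rewrite lerDl.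
Qed.

(** By the mean value theorem a difference quotient is a value of [pd j f] at distance at most |h|;
    uniform continuity makes the convergence uniform in x. *)
Lemma dquot_cvg M f j : C1csupp M f -> forall e, 0 < e ->
  exists2 d, 0 < d & forall h, h != 0 -> `|h| < d ->
    forall x, `|dquot j h f x - pd j f x| <= e.
Proof.
move=> [cf df cpf] e e0; have [d d0 dpf] := ccsupp_ucont (cpf j) e0.
exists d => // h h0 hd x.
have [c ch Ec] := @MVT_line f x j h (fun t _ => df (x + t *: evec j) j).
rewrite /dquot Ec mulrCA mulVf // mulr1; apply: dpf.
rewrite addrAC subrr add0r.
apply: (@le_lt_trans _ _ `|c|); first exact: norm_scale_evec.
exact: le_lt_trans hd.
Qed.

Lemma small_pos (d : R) : 0 < d -> exists h : R, [/\ 0 < h, h < d & h <= 1].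
Proof.
move=> d0; exists (Num.min (d / 2) 1).
have d2 : 0 < d / 2 by lra.
split; first by rewrite lt_min d2 ltr01.
  by rewrite (@le_lt_trans _ _ (d / 2)) ?ge_min ?lexx //; lra.
by rewrite ge_min lexx orbT.
Qed.

(** Difference quotients integrate to zero by translation invariance and converge uniformly, with
    supports in the fixed cube of radius M + 1. *)
Lemma intRn_pd M f j : 0 <= M -> C1csupp M f -> intRn (pd j f) = 0.
Proof.
move=> M0 cf; have [cf0 _ cpf] := cf.
have M10 : 0 <= M + 1 by lra.
apply: (@eq0_small _ _ ((2 * (M + 1)) ^+ n)) => e e0.
have [d d0 dd] := dquot_cvg j cf e0.
have [h [h0 hd h1]] := small_pos d0.
have nh : `|h| = h by rewrite gtr0_norm.
have cf1 : ccsupp (M + 1) f by apply: ccsupp_le cf0; lra.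
have cfs : ccsupp (M + 1) (fun x => f (x + h *: evec j)).
  by apply: ccsupp_le (ccsupp_shift j h cf0); lra.
have cp1 : ccsupp (M + 1) (pd j f) by apply: ccsupp_le (cpf j); lra.
have cd : ccsupp (M + 1) (dquot j h f) by apply: ccsupp_dquot; rewrite ?nh.
have Jd : intRn (dquot j h f) = 0.
  rewrite (intRnZ _ M10); last first.
    exact: ccsuppB cfs cf1.
  by rewrite (intRnB M10 cfs cf1) (intRn_shift _ _ M0 cf0) subrr mulr0.
have := @intRn_le _ _ (M + 1) (fun x => dquot j h f x - pd j f x) e M10.
rewrite (intRnB M10 cd cp1) Jd sub0r normrN; apply.
  exact: ccsuppB.
by apply: dd; rewrite ?gt_eqF ?nh.
Qed.

Lemma intRn_dquot_mul_cvg M f g j k : 0 <= M -> C1csupp M f -> C1csupp M g ->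
  exists C, forall e, 0 < e -> exists2 d, 0 < d & forall h, h != 0 -> `|h| < d ->
  `|intRn (fun x => dquot j h f x * dquot k h g x) - intRn (fun x => pd j f x * pd k g x)|
    <= C * e.
Proof.
move=> M0 cf cg; have M10 : 0 <= M + 1 by lra.
have [cf0 _ cpf] := cf; have [cg0 _ cpg] := cg.
have [B B0 fB] := ccsupp_bounded (cpf j); have [B' B'0 gB] := ccsupp_bounded (cpg k).
(* Volume of the cube times the pointwise error: with a and b the quotients, ab - pq = (a - p)(b -
   q) + (a - p)q + p(b - q) is at most e (1 + B' + B) as soon as e <= 1. *)
exists ((2 * (M + 1)) ^+ n * (B + B' + 1)) => e e0.
wlog e1 : e e0 / e <= 1.
  move=> H; have [e1|e1] := leP e 1; first exact: H.
  have [d d0 Hd] := H 1 ltr01 (lexx 1); exists d => // h h0 hd.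
  apply: (le_trans (Hd h h0 hd)); rewrite ler_wpM2l ?(ltW e1) //.
  by rewrite mulr_ge0 // ?exprn_ge0 ?mulr_ge0 // !addr_ge0.
have [d d0 dd] := dquot_cvg j cf e0; have [d' d'0 dd'] := dquot_cvg k cg e0.
exists (Num.min 1 (Num.min d d')); first by rewrite !lt_min ltr01 d0.
move=> h h0; rewrite !lt_min => /and3P[h1 hd hd'].
have c1 : ccsupp (M + 1) (fun x => dquot j h f x * dquot k h g x).
  apply: ccsuppM; last by apply: ccsupp_dquot => //; exact: ltW.
  by have [] := ccsupp_dquot j (ltW h1) cf0.
have c2 : ccsupp (M + 1) (fun x => pd j f x * pd k g x).
  by apply: ccsuppM; [case: (cpf j)|apply: ccsupp_le (cpg k); lra].
rewrite -(intRnB M10 c1 c2) -mulrA; apply: intRn_le => //.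
  exact: ccsuppB.
move=> x; set a := dquot j h f x; set b := dquot k h g x.
have -> : a * b - pd j f x * pd k g x =
  (a - pd j f x) * (b - pd k g x) + (a - pd j f x) * pd k g x + pd j f x * (b - pd k g x).
  by ring.
have Ha : `|a - pd j f x| <= e by exact: dd.
have Hb : `|b - pd k g x| <= e by exact: dd'.
have h2 : `|(a - pd j f x) * (b - pd k g x)| <= e * 1.
  by rewrite normrM ler_pM // (le_trans Hb).
have h3 : `|(a - pd j f x) * pd k g x| <= e * B' by rewrite normrM ler_pM.
have h4 : `|pd j f x * (b - pd k g x)| <= B * e by rewrite normrM ler_pM.
apply: (le_trans (ler_normD _ _)); apply: (le_trans (lerD (ler_normD _ _) (lexx _))).
by apply: (le_trans (lerD (lerD h2 h3) h4)); lra.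
Qed.

(* Translation invariance moves the two difference quotients from one factor to
   the other, so no second derivative of either factor is involved. *)
Lemma intRn_pd_swap M f g j k : 0 <= M -> C1csupp M f -> C1csupp M g ->
  intRn (fun x => pd j f x * pd k g x) = intRn (fun x => pd k f x * pd j g x).
Proof.
move=> M0 cf cg; apply/eqP; rewrite -subr_eq0; apply/eqP.
have [cf0 _ _] := cf; have [cg0 _ _] := cg.
have [C HC] := intRn_dquot_mul_cvg j k M0 cf cg.
have [C' HC'] := intRn_dquot_mul_cvg k j M0 cf cg.
apply: (@eq0_small _ _ (C + C')) => e e0.
have [d d0 Hd] := HC e e0; have [d' d'0 Hd'] := HC' e e0.
have [|h [h0 hd h1]] := @small_pos (Num.min d d'); first by rewrite lt_min d0.
move: hd; rewrite lt_min => /andP[hd hd'].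
have nh : `|h| = h by rewrite gtr0_norm.
have := Hd h; rewrite gt_eqF // nh => /(_ isT hd).
have := Hd' (- h); rewrite oppr_eq0 gt_eqF // normrN nh => /(_ isT hd').
(* The swapped quotients use the step - h, so that translations carry their four expanded integrals
   exactly onto those of the original pair. *)
suff -> : intRn (fun x => dquot k (- h) f x * dquot j (- h) g x) =
          intRn (fun x => dquot j h f x * dquot k h g x).
  move=> H1 H2; rewrite mulrDl.
  set X := intRn (fun x => dquot j h f x * dquot k h g x) in H1 H2.
  rewrite -(subrKA X); apply: (le_trans (ler_normD _ _)).
  by rewrite (distrC _ X) lerD.
pose tf i (t : R) x := f (x + t *: evec i); pose tg i (t : R) x := g (x + t *: evec i).
have M20 : 0 <= M + 2 by lra.
have cU (F : V -> R) i t : `|t| <= 1 -> ccsupp M F ->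
    ccsupp (M + 1) (fun x => F (x + t *: evec i)).
  by move=> t1 cF; apply: ccsupp_le (ccsupp_shift i t cF); lra.
have cM (F G : V -> R) : ccsupp (M + 1) F -> ccsupp (M + 1) G ->
    ccsupp (M + 2) (fun x => F x * G x).
  by move=> [cF _] cG; apply: ccsuppM cF _; apply: ccsupp_le cG; lra.
have cf1 : ccsupp (M + 1) f by apply: ccsupp_le cf0; lra.
have cg1 : ccsupp (M + 1) g by apply: ccsupp_le cg0; lra.
have hN : `|- h| <= 1 by rewrite normrN nh.
have hP : `|h| <= 1 by rewrite nh.
have expand i l t : `|t| <= 1 ->
  intRn (fun x => dquot i t f x * dquot l t g x) = t^-1 * t^-1 *
   (intRn (fun x => tf i t x * tg l t x) + intRn (fun x => f x * g x)
    - (intRn (fun x => tf i t x * g x) + intRn (fun x => f x * tg l t x))).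
  move=> t1.
  have e1 : ccsupp (M + 2) (fun x => tf i t x * tg l t x) by apply: cM; exact: cU.
  have e2 : ccsupp (M + 2) (fun x => f x * g x) by apply: cM.
  have e3 : ccsupp (M + 2) (fun x => tf i t x * g x) by apply: cM => //; exact: cU.
  have e4 : ccsupp (M + 2) (fun x => f x * tg l t x) by apply: cM => //; exact: cU.
  rewrite -(intRnD M20 e1 e2) -(intRnD M20 e3 e4) -(intRnB M20); [|exact: ccsuppD|exact: ccsuppD].
  rewrite -(intRnZ _ M20); last first.
    by apply: ccsuppB; exact: ccsuppD.
  by apply: eq_intRn => x; rewrite /dquot /tf /tg; ring.
rewrite !expand // !invrN mulrNN; congr (_ * _).
have sh (F : V -> R) i t : ccsupp (M + 2) F -> intRn (fun x => F (x + t *: evec i)) = intRn F.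
  by move=> cF; exact: intRn_shift M20 cF.
have cX i t : `|t| <= 1 -> ccsupp (M + 2) (fun x => tf i t x * g x).
  by move=> t1; apply: cM => //; exact: cU.
have cY i t : `|t| <= 1 -> ccsupp (M + 2) (fun x => f x * tg i t x).
  by move=> t1; apply: cM => //; exact: cU.
have S1 : intRn (fun x => tf k (- h) x * g x) = intRn (fun x => f x * tg k h x).
  rewrite -(sh _ k h (cX k _ hN)); apply: eq_intRn => x; rewrite /tf /tg.
  by rewrite scaleNr addrK.
have S2 : intRn (fun x => f x * tg j (- h) x) = intRn (fun x => tf j h x * g x).
  rewrite -(sh _ j h (cY j _ hN)); apply: eq_intRn => x; rewrite /tf /tg.
  by rewrite scaleNr addrK.
have S3 : intRn (fun x => tf k (- h) x * tg j (- h) x) = intRn (fun x => tf j h x * tg k h x).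
  have c0 : ccsupp (M + 2) (fun x => tf k (- h) x * tg j (- h) x).
    by apply: cM; exact: cU.
  (* Translating by h along both j and k turns f(x - h e_k) g(x - h e_j) into f(x + h e_j) g(x + h
     e_k); the second translation acts on a translate, hence the radius M + 3. *)
  rewrite -(sh _ j h c0) -(@intRn_shift _ _ (M + 3) _ k h); [|lra|]; last first.
    by apply: ccsupp_le (ccsupp_shift j h c0); lra.
  apply: eq_intRn => x; rewrite /tf /tg !scaleNr; congr (f _ * g _).
    by rewrite (addrAC x) addrK.
  by rewrite addrK.
by rewrite S1 S2 S3; congr (_ - _); rewrite addrC.
Qed.

End Directional.

(** * Functions of class C^k off the origin *)

Section Ck.
Variables (R : realType) (n : nat).
Notation V := 'rV[R]_n.
Notation evec := (@evec R n).
Notation rad := (@Defs.rad R n).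
Implicit Types (f g : V -> R) (x y : V) (h e p : R) (i j : 'I_n) (k : nat).

Lemma near_neq0 x : x != 0 -> \forall y \near x, y != 0.
Proof.
move=> x0; near=> y; apply/eqP => y0.
have : `|x - y| < `|x|.
  by near: y; apply: (@cvgr_dist_lt _ _ _ _ _ id) => //; rewrite normr_gt0.
by rewrite y0 subr0 ltxx.
Unshelve. all: by end_near. Qed.

Lemma near_eq0 f g x : (forall y, y != 0 -> f y = g y) -> x != 0 ->
  \forall y \near x, f y = g y.
Proof. by move=> fg /near_neq0; apply: filterS => y; exact: fg. Qed.

Lemma eq_pd f g j x : (forall y, y != 0 -> f y = g y) -> x != 0 ->
  pd j f x = pd j g x.
Proof. by move=> fg x0; apply: near_eq_derive; exact: near_eq0. Qed.

Lemma eq_Ck k f g : (forall y, y != 0 -> f y = g y) -> Ck k f -> Ck k g.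
Proof.
elim: k f g => [|k IH] f g fg /=.
  move=> cf x x0; rewrite /prop_for /continuous_at -(fg x x0).
  exact: (cvg_trans (near_eq_cvg (near_eq0 fg x0)) (cf x x0)).
move=> [df cpf]; split=> [x j x0|j].
  by apply: near_eq_derivable (df x j x0); exact: near_eq0.
by apply: IH (cpf j) => y y0; exact: eq_pd.
Qed.

(** [Ck 1] speaks of partial derivatives only, so continuity of [f] has to be derived: the
    coordinates of x are replaced by those of y one at a time, and each move costs at most K |x - y|
    by the mean value theorem, K bounding all partial derivatives near x. *)
Lemma Ck1_continuous f : Ck 1 f -> Ck 0 f.
Proof.
move=> [df cpf]; suff: forall x, x != 0 -> f @ x --> f x by [].
move=> x x0; pose K := \sum_j (`|pd j f x| + 1).
have K0 : 0 <= K by apply: sumr_ge0 => j _; rewrite addr_ge0.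
have nK : \forall y \near x, forall j, `|pd j f y| <= K.
  apply: (@filter_forall V 'I_n (fun j y => `|pd j f y| <= K) (nbhs x) (nbhs_filter x)) => j.
  near=> y.
  have h2 : `|pd j f x - pd j f y| < 1.
    by near: y; apply: cvgr_dist_lt => //; exact: (cpf j x x0).
  have h3 : `|pd j f x| + 1 <= K.
    rewrite /K (bigD1 j) //= lerDl; apply: sumr_ge0 => l _.
    by rewrite addr_ge0.
  have h4 : `|pd j f y| <= `|pd j f x| + `|pd j f x - pd j f y|.
    have := ler_normB (pd j f x) (pd j f x - pd j f y).
    by rewrite opprB addrC subrK.
  lra.
have : \forall y \near x, y != 0 /\ forall j, `|pd j f y| <= K.
  by near=> y; split; near: y => //; exact: near_neq0.
move=> /nbhs_normP[r /= r0 rP].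
(* The corners of the path from x to y; in the sup norm the whole path stays in the ball of radius r
   about x. *)
pose z (y : V) m : V := \row_i (if (i < m)%N then y ord0 i else x ord0 i).
have step y m : `|x - y| < r -> (m <= n)%N ->
    `|f (z y m) - f x| <= m%:R * (K * `|x - y|).
  move=> xy; elim: m => [|m IH] mn.
    have -> : z y 0%N = x by apply/rowP => i; rewrite mxE.
    by rewrite subrr normr0 mul0r.
  pose j := Ordinal mn; pose h := y ord0 j - x ord0 j.
  have hxy : `|h| <= `|x - y|.
    by have := ler_coord_norm (x - y) j; rewrite !mxE distrC.
  have zS : z y m.+1 = z y m + h *: evec j.
    apply/rowP => i; rewrite !mxE ltnS leq_eqVlt.
    have -> : (i == m :> nat) = (i == j) by [].
    case: eqP => [->|_] /=; first by rewrite ltnn mulr1 /h addrC subrK.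
    by rewrite mulr0 addr0.
  have zr (t : R) : `|t| <= `|h| -> `|x - (z y m + t *: evec j)| < r.
    move=> th; apply: ltr_norm_coord => // i; rewrite !mxE.
    have xyi : `|x ord0 i - y ord0 i| < r.
      by have := ler_coord_norm (x - y) i; rewrite !mxE => /le_lt_trans; apply.
    have [->|ij] := eqVneq i j.
      by rewrite ltnn mulr1 opprD addrA subrr sub0r normrN (le_lt_trans th) // (le_lt_trans hxy).
    rewrite mulr0 addr0; case: ifP => _ //.
    by rewrite subrr normr0.
  have [|c ch Ec] := @MVT_line _ _ f (z y m) j h.
    by move=> t /zr /rP[z0 _]; exact: df.
  have fc : `|f (z y m.+1) - f (z y m)| <= K * `|x - y|.
    rewrite zS Ec normrM ler_pM //.
    by have [_] := rP _ (zr _ ch); apply.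
  rewrite -(subrKA (f (z y m))); apply: (le_trans (ler_normD _ _)).
  by rewrite -natr1 mulrDl mul1r addrC lerD // IH // ltnW.
apply/(@cvgrPdist_le _ _ _ (nbhs x) (nbhs_filter x)) => e e0.
have C0 : 0 < n%:R * K + 1 by rewrite ltr_wpDl // mulr_ge0.
near=> y.
have xyr : `|x - y| < r by near: y; exact: (@cvgr_dist_lt _ _ _ _ _ id).
have zn : z y n = y by apply/rowP => i; rewrite mxE ltn_ord.
have := step y n xyr (leqnn n); rewrite zn distrC => /le_trans; apply.
have : `|x - y| < e / (n%:R * K + 1).
  by near: y; apply: (@cvgr_dist_lt _ _ _ _ _ id) => //; rewrite divr_gt0.
rewrite ltr_pdivlMr // mulrDr mulr1 mulrA => h1.
by rewrite (le_trans _ (ltW h1)) // mulrC lerDl.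
Unshelve. all: by end_near. Qed.

Lemma CkS k f : Ck k.+1 f -> Ck k f.
Proof.
elim: k f => [|k IH] f; first exact: Ck1_continuous.
by move=> [df cpf]; split => // j; exact: IH.
Qed.

Lemma Ck_derivable k f x j : Ck k.+1 f -> x != 0 -> derivable f x (evec j).
Proof. by move=> [df _]; exact: df. Qed.
Arguments Ck_derivable {k f x} j _ _.

Lemma Ck_pd k f j : Ck k.+1 f -> Ck k (pd j f).
Proof. by move=> [_ cpf]; exact: cpf. Qed.

Lemma Ck_cst k (c : R) : Ck k (fun _ : V => c).
Proof.
elim: k c => [|k IH] c /=; first by move=> x _; exact: cst_continuous.
split=> [x j _|j]; first exact: derivable_cst.
have -> : pd j (fun _ : V => c) = (fun _ : V => 0) by apply/funext => x; exact: derive_cst.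
exact: IH.
Qed.

Lemma derivable_addf f g x j : derivable f x (evec j) -> derivable g x (evec j) ->
  derivable (fun y => f y + g y) x (evec j).
Proof. exact: derivableD. Qed.
Arguments derivable_addf {f g x j} _ _.

Lemma derivable_mulf f g x j : derivable f x (evec j) -> derivable g x (evec j) ->
  derivable (fun y => f y * g y) x (evec j).
Proof. exact: derivableM. Qed.
Arguments derivable_mulf {f g x j} _ _.

Lemma pdD f g x j : derivable f x (evec j) -> derivable g x (evec j) ->
  pd j (fun y => f y + g y) x = pd j f x + pd j g x.
Proof. exact: deriveD. Qed.

Lemma pdM f g x j : derivable f x (evec j) -> derivable g x (evec j) ->
  pd j (fun y => f y * g y) x = f x * pd j g x + g x * pd j f x.
Proof. exact: deriveM. Qed.

Lemma CkD k f g : Ck k f -> Ck k g -> Ck k (fun x => f x + g x).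
Proof.
elim: k f g => [|k IH] f g.
  by move=> cf cg x x0; exact: (continuousD (cf x x0) (cg x x0)).
move=> cf cg; split=> [x j x0|j].
  exact: (derivable_addf (Ck_derivable j cf x0) (Ck_derivable j cg x0)).
apply: (@eq_Ck _ (fun x => pd j f x + pd j g x)); last by apply: IH; exact: Ck_pd.
by move=> y y0; rewrite (pdD (Ck_derivable j cf y0) (Ck_derivable j cg y0)).
Qed.

Lemma CkM k f g : Ck k f -> Ck k g -> Ck k (fun x => f x * g x).
Proof.
elim: k f g => [|k IH] f g.
  by move=> cf cg x x0; exact: (continuousM (cf x x0) (cg x x0)).
move=> cf cg; split=> [x j x0|j].
  exact: (derivable_mulf (Ck_derivable j cf x0) (Ck_derivable j cg x0)).
apply: (@eq_Ck _ (fun x => f x * pd j g x + g x * pd j f x)); last first.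
  by apply: CkD; apply: IH; [exact: CkS|exact: Ck_pd|exact: CkS|exact: Ck_pd].
by move=> y y0; rewrite (pdM (Ck_derivable j cf y0) (Ck_derivable j cg y0)).
Qed.

Lemma CkZ k (c : R) f : Ck k f -> Ck k (fun x => c * f x).
Proof. by apply: CkM; exact: Ck_cst. Qed.

Lemma CkB k f g : Ck k f -> Ck k g -> Ck k (fun x => f x - g x).
Proof.
move=> cf cg; apply: (eq_Ck _ (CkD cf (CkZ (-1) cg))) => y _.
by rewrite mulN1r.
Qed.

Lemma Ck_sum k m (F : 'I_m -> V -> R) : (forall l, Ck k (F l)) ->
  Ck k (fun x => \sum_l F l x).
Proof.
elim: m F => [|m IH] F cF.
  by apply: eq_Ck (Ck_cst k 0) => y _; rewrite big_ord0.
apply: (@eq_Ck _ (fun x => \sum_(l < m) F (widen_ord (leqnSn m) l) x + F ord_max x)).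
  by move=> y _; rewrite big_ord_recr.
by apply: CkD; [apply: IH => l|]; exact: cF.
Qed.

Lemma is_derive_coord x (v : V) i : is_derive x v (fun y : V => y ord0 i) (v ord0 i).
Proof.
apply: DeriveDef; first by apply: diff_derivable; exact: differentiable_coord.
have := @derive_mx _ _ _ _ (id : V -> V) x v (@ex_derive _ _ _ _ _ _ _ (is_derive_id x v)).
by rewrite derive_id => /rowP/(_ i); rewrite !mxE => <-.
Qed.

Lemma pd_coord x i j : pd j (fun y : V => y ord0 i) x = (i == j)%:R.
Proof.
rewrite /pd (@derive_val _ _ _ _ _ _ _ (is_derive_coord x (evec j) i)) mxE.
by case: eqP.
Qed.

Lemma Ck_coord k i : Ck k (fun y : V => y ord0 i).
Proof.
case: k => [|k]; first by move=> x _; exact: coord_continuous.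
split=> [x j _|j]; first by apply: diff_derivable; exact: differentiable_coord.
by apply: eq_Ck (Ck_cst k (i == j)%:R) => y _; rewrite pd_coord.
Qed.

(** * Powers of the radius *)

Definition radpow p x : R := rad x `^ p.

Definition sqn x : R := \sum_i x ord0 i ^+ 2.

Lemma sqn_gt0 x : x != 0 -> 0 < sqn x.
Proof.
move=> x0; rewrite lt_neqAle sumr_ge0 ?andbT; last by move=> i _; rewrite sqr_ge0.
apply: contra x0; rewrite eq_sym psumr_eq0; last by move=> i _; rewrite sqr_ge0.
move=> /allP xi; apply/eqP/rowP => i; rewrite mxE; apply/eqP.
by rewrite -sqrf_eq0; apply: xi; rewrite mem_index_enum.
Qed.

(** Differentiation goes through the polynomial r^2 and a real power, so the square root in [rad] is
    never differentiated. *)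
Lemma radpowE p x : radpow p x = sqn x `^ (p / 2).
Proof.
rewrite /radpow /Defs.rad -/(sqn x) -powR12_sqrt; last by apply: sumr_ge0 => i _; rewrite sqr_ge0.
by rewrite -powRrM mulrC.
Qed.

Lemma rad_gt0 x : x != 0 -> 0 < rad x.
Proof. by move=> x0; rewrite sqrtr_gt0; exact: sqn_gt0. Qed.

Lemma sum_sqr_rad x : \sum_i x ord0 i ^+ 2 = rad x ^+ 2.
Proof. by rewrite sqr_sqrtr //; apply: sumr_ge0 => i _; rewrite sqr_ge0. Qed.

Lemma differentiable_sqn x : differentiable sqn x.
Proof.
have -> : sqn = \sum_(i < n) (fun y : V => y ord0 i) ^+ 2.
  by apply/funext => y; rewrite fct_sumE.
apply: differentiable_sum => i; apply: differentiableX; exact: differentiable_coord.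
Qed.

Lemma pd_sqn x j : pd j sqn x = 2 * x ord0 j.
Proof.
have -> : sqn = \sum_(i < n) (fun y : V => y ord0 i) ^+ 2.
  by apply/funext => y; rewrite fct_sumE.
rewrite /pd derive_sum; last first.
  by move=> i; apply: derivableX; apply: diff_derivable; exact: differentiable_coord.
rewrite (bigD1 j) //= big1 ?addr0.
  rewrite deriveX; last by apply: diff_derivable; exact: differentiable_coord.
  by have := pd_coord x j j; rewrite /pd eqxx => ->; rewrite expr1 [_ *: _]mulr1.
move=> i ij; rewrite deriveX; last by apply: diff_derivable; exact: differentiable_coord.
by have := pd_coord x i j; rewrite /pd (negbTE ij) => ->; rewrite scaler0.
Qed.

Lemma derive_comp_scalar (g : R -> R) (q : V -> R) x (v : V) : differentiable q x ->
  derivable g (q x) 1 -> 'D_v (g \o q) x = g^`()%classic (q x) * 'D_v q x.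
Proof.
move=> dq dg; have dg' := (derivable1_diffP _ _).1 dg.
rewrite deriveE; last exact: differentiable_comp.
by rewrite diff_comp //= deriv1E // -deriveE // mulrC.
Qed.

Lemma is_derive_radpow p x j : x != 0 ->
  is_derive x (evec j) (radpow p) (p * x ord0 j * radpow (p - 2) x).
Proof.
move=> x0; have q0 := sqn_gt0 x0.
have -> : radpow p = (fun t => t `^ (p / 2)) \o sqn.
  by apply/funext => y; rewrite radpowE.
have dg : derivable (fun t : R => t `^ (p / 2)) (sqn x) 1.
  by apply: derivable_powR; rewrite in_itv /= q0.
have dg' := (derivable1_diffP _ _).1 dg.
have dq := differentiable_sqn x.
have dc : differentiable ((fun t => t `^ (p / 2)) \o sqn) x.
  exact: differentiable_comp.
apply: DeriveDef; first exact: diff_derivable.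
have := pd_sqn x j; rewrite derive_comp_scalar // /pd => ->.
rewrite powR_derive1; last by rewrite in_itv /= q0.
rewrite radpowE; have -> : (p - 2) / 2 = p / 2 - 1 by field.
by field.
Qed.

Lemma pd_radpow p x j : x != 0 ->
  pd j (radpow p) x = p * x ord0 j * radpow (p - 2) x.
Proof. by move=> x0; exact: (@derive_val _ _ _ _ _ _ _ (is_derive_radpow p j x0)). Qed.

(** The family of all real powers is closed under differentiation up to a coordinate factor, hence
    an induction on k for all p at once. *)
Lemma Ck_radpow k p : Ck k (radpow p).
Proof.
elim: k p => [|k IH] p; last first.
  split=> [x j x0|j]; first by have [] := is_derive_radpow p j x0.
  apply: (@eq_Ck _ (fun x => p * x ord0 j * radpow (p - 2) x)).
    by move=> y y0; rewrite pd_radpow.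
  by apply: CkM => //; apply: CkZ; exact: Ck_coord.
move=> x x0; have q0 := sqn_gt0 x0.
have -> : radpow p = (fun t => t `^ (p / 2)) \o sqn.
  by apply/funext => y; rewrite radpowE.
apply: differentiable_continuous; apply: differentiable_comp.
  exact: differentiable_sqn.
by apply/derivable1_diffP/derivable_powR; rewrite in_itv /= q0.
Qed.

(** * Symmetry of second derivatives *)

Lemma derivable_translate f x (v w : V) : derivable f (x + w) v ->
  is_derive x v (fun y => f (y + w)) ('D_v f (x + w)).
Proof.
move=> df.
have E : (fun h : R => h^-1 *: (((fun y : V => f (y + w)) \o shift x) (h *: v) - f (x + w)))
       = (fun h : R => h^-1 *: ((f \o shift (x + w)) (h *: v) - f (x + w))).
  by apply/funext => h /=; rewrite addrA.
apply: DeriveDef; first by rewrite /derivable E.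
by rewrite /derive E.
Qed.

(** Two mean value steps: along e_i for y -> f (y + h e_j) - f y, then along e_j for [pd i f]. *)
Lemma second_difference f x i j h (r : R) : Ck 2 f ->
  (forall y, `|x - y| < r -> y != 0) -> 0 < h -> h * 2 < r ->
  exists2 z, `|x - z| < r &
  f (x + h *: evec i + h *: evec j) - f (x + h *: evec i)
    - (f (x + h *: evec j) - f x) = pd j (pd i f) z * h * h.
Proof.
move=> cf xr h0 hr; pose G y := f (y + h *: evec j) - f y.
have nh : `|h| = h by rewrite gtr0_norm.
have dist (s t : R) : `|s| <= h -> `|t| <= h -> `|x - (x + s *: evec i + t *: evec j)| < r.
  move=> sh th; rewrite -addrA opprD addrA subrr sub0r normrN.
  apply: (le_lt_trans (ler_normD _ _)).
  have := norm_scale_evec s i; have := norm_scale_evec t j; lra.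
have df y l : `|x - y| < r -> derivable f y (evec l).
  by move=> /xr; exact: (Ck_derivable _ cf).
have GP (t : R) : `|t| <= `|h| -> is_derive (x + t *: evec i) (evec i) G
    (pd i f (x + t *: evec i + h *: evec j) - pd i f (x + t *: evec i)).
  rewrite nh => th; apply: is_deriveB.
    by apply: derivable_translate; apply: df; apply: dist; rewrite ?nh.
  apply: derivableP; apply: df.
  by have := dist t 0 th; rewrite normr0 scale0r addr0 => /(_ (ltW h0)).
have [|c ch Ec] := @MVT_line _ _ G x i h.
  by move=> t /GP [].
have [|c' ch' Ec'] := @MVT_line _ _ (pd i f) (x + c *: evec i) j h.
  move=> t th; apply: (Ck_derivable _ (Ck_pd i cf)); apply: xr.
  by apply: dist; rewrite -nh.
exists (x + c *: evec i + c' *: evec j); first by apply: dist; rewrite -nh.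
have EG := @derive_val _ _ _ _ _ _ _ (GP c ch).
by rewrite -Ec' -[X in _ = X * h]EG -[RHS]Ec.
Qed.

Lemma near_quotient (h S a b A B e : R) : 0 < h -> S = a * h * h -> S = b * h * h ->
  `|A - a| <= e -> `|B - b| <= e -> `|A - B| <= 2 * e.
Proof.
move=> h0 -> /(mulIf (lt0r_neq0 h0)) /(mulIf (lt0r_neq0 h0)) -> Ab.
by rewrite distrC => bB; have := ler_normD (A - b) (b - B); rewrite subrKA; lra.
Qed.

(** The second difference is symmetric in i and j, so divided by h^2 it is a value near x of either
    mixed derivative; both are continuous at x. *)
Lemma pdC f i j x : Ck 2 f -> x != 0 -> pd i (pd j f) x = pd j (pd i f) x.
Proof.
move=> cf x0; apply/eqP; rewrite -subr_eq0; apply/eqP.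
apply: (@eq0_small _ _ 2) => e e0.
have c1 : {for x, continuous (pd i (pd j f))} := Ck_pd i (Ck_pd j cf) x x0.
have c2 : {for x, continuous (pd j (pd i f))} := Ck_pd j (Ck_pd i cf) x x0.
have nr (F : V -> R) : {for x, continuous F} -> \forall y \near x, `|F x - F y| <= e.
  by move=> cF; exact: (@cvgr_dist_le _ _ _ (nbhs x) (nbhs_filter x) F (F x)).
have : \forall y \near x, [/\ y != 0, `|pd i (pd j f) x - pd i (pd j f) y| <= e &
    `|pd j (pd i f) x - pd j (pd i f) y| <= e].
  by apply: filterS (filterI (near_neq0 x0) (filterI (nr _ c1) (nr _ c2))) => y [? []].
move=> /nbhs_normP[r /= r0 rP].
have xr y : `|x - y| < r -> y != 0 by move=> /rP[].
(* Two steps of length h must stay within the ball of radius r. *)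
pose h := r / 3; have h0 : 0 < h by rewrite /h; lra.
have hr : h * 2 < r by rewrite /h; lra.
have [z zr Ez] := @second_difference f x i j h r cf xr h0 hr.
have [z' zr' Ez'] := @second_difference f x j i h r cf xr h0 hr.
have Sxy : f (x + h *: evec j + h *: evec i) - f (x + h *: evec j)
      - (f (x + h *: evec i) - f x) =
    f (x + h *: evec i + h *: evec j) - f (x + h *: evec i) - (f (x + h *: evec j) - f x).
  by rewrite (addrAC x); ring.
have [_ H1 _] := rP _ zr'; have [_ _ H2] := rP _ zr.
exact: (near_quotient h0 (etrans (esym Sxy) Ez') Ez H1 H2).
Qed.

End Ck.

Arguments Ck_derivable {R n k f x} j _ _.

(** * Radial calculus *)

(* Otherwise comparing mixed partial derivatives unfolds [pd] down to limits. *)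
Opaque pd.

Section Annulus.
Variables (R : realType) (n : nat).
Notation V := 'rV[R]_n.
Notation evec := (@evec R n).
Notation rad := (@Defs.rad R n).
Notation intRn := (@intRn R n).
Notation W := (@radpow R n).
Implicit Types (f g w : V -> R) (x y : V) (a p : R) (i j : 'I_n) (k : nat).

Definition unitc i x : R := x ord0 i / rad x.
Notation th := unitc.

Lemma radpowN1 x : W (-1) x = (rad x)^-1.
Proof. by rewrite /radpow powR_inv1 // sqrtr_ge0. Qed.

Lemma radpowB1 p x : x != 0 -> W (p - 1) x = W p x / rad x.
Proof.
move=> x0; rewrite /radpow powRD; last by rewrite (gt_eqF (rad_gt0 x0)) implybT.
by rewrite -/(W (-1) x) radpowN1.
Qed.

Lemma Ck_radV k : Ck k (fun x => (rad x)^-1).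
Proof. by apply: eq_Ck (Ck_radpow n k (-1)) => y _; rewrite radpowN1. Qed.

Lemma Ck_unitc k i : Ck k (th i).
Proof. by apply: CkM; [exact: Ck_coord|exact: Ck_radV]. Qed.

Lemma sum_unitc_sqr x : x != 0 -> \sum_i th i x * th i x = 1.
Proof.
move=> x0; have r0 := lt0r_neq0 (rad_gt0 x0).
under eq_bigr => i _ do rewrite /unitc mulf_div -expr2.
by rewrite -mulr_suml sum_sqr_rad -expr2 divff // sqrf_eq0.
Qed.

Lemma pd_radpow_unitc p x j : x != 0 -> pd j (W p) x = p * W p x / rad x * th j x.
Proof.
move=> x0; rewrite pd_radpow // (_ : p - 2 = p - 1 - 1); last by ring.
by rewrite !radpowB1 // /unitc; field; exact: lt0r_neq0 (rad_gt0 x0).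
Qed.

Lemma pd_unitc x i j : x != 0 ->
  pd j (th i) x = ((i == j)%:R - th i x * th j x) / rad x.
Proof.
move=> x0.
rewrite (@eq_pd _ _ _ (fun y => y ord0 i * W (-1) y)) //; last first.
  by move=> y _; rewrite radpowN1.
rewrite (pdM (Ck_derivable j (Ck_coord R 1 i) x0) (Ck_derivable j (Ck_radpow n 1 (-1)) x0)).
rewrite pd_coord pd_radpow_unitc // radpowN1 /unitc.
by field; exact: lt0r_neq0 (rad_gt0 x0).
Qed.

Lemma drD f g x : Ck 1 f -> Ck 1 g -> x != 0 ->
  dr (fun y => f y + g y) x = dr f x + dr g x.
Proof.
move=> cf cg x0; rewrite /dr -big_split; apply: eq_bigr => i _ /=.
by rewrite (pdD (Ck_derivable i cf x0) (Ck_derivable i cg x0)) mulrDr.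
Qed.

Lemma drM f g x : Ck 1 f -> Ck 1 g -> x != 0 ->
  dr (fun y => f y * g y) x = f x * dr g x + g x * dr f x.
Proof.
move=> cf cg x0; rewrite /dr !mulr_sumr -big_split; apply: eq_bigr => i _ /=.
rewrite (pdM (Ck_derivable i cf x0) (Ck_derivable i cg x0)); ring.
Qed.

Lemma dr_cst (c : R) x : dr (fun _ : V => c) x = 0.
Proof.
rewrite /dr big1 // => i _.
have -> : pd i (fun _ : V => c) x = 0 by exact: derive_cst.
by rewrite mulr0.
Qed.

Lemma drZ (c : R) f x : Ck 1 f -> x != 0 -> dr (fun y => c * f y) x = c * dr f x.
Proof. by move=> cf x0; rewrite drM //; [rewrite dr_cst mulr0 addr0|exact: Ck_cst]. Qed.

Lemma dr_radpow p x : x != 0 -> dr (W p) x = p * W p x / rad x.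
Proof.
move=> x0; rewrite /dr -[RHS]mulr1 -(sum_unitc_sqr x0) mulr_sumr.
by apply: eq_bigr => i _; rewrite pd_radpow_unitc // -/(th i x) mulrCA.
Qed.

(** The function x_i / r is constant along rays. *)
Lemma dr_unitc i x : x != 0 -> dr (th i) x = 0.
Proof.
move=> x0; rewrite /dr.
transitivity (\sum_j ((i == j)%:R * th j x - th i x * (th j x * th j x)) / rad x).
  by apply: eq_bigr => j _; rewrite pd_unitc // /unitc; ring.
rewrite -mulr_suml sumrB -mulr_sumr sum_unitc_sqr // mulr1 (bigD1 i) //= eqxx mul1r.
rewrite big1 ?addr0 ?subrr ?mul0r // => j ji.
by rewrite eq_sym (negbTE ji) mul0r.
Qed.

Lemma eq_dr f g x : (forall y, y != 0 -> f y = g y) -> x != 0 -> dr f x = dr g x.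
Proof. by move=> fg x0; apply: eq_bigr => i _; rewrite (eq_pd i fg). Qed.

Lemma dr_sum m (F : 'I_m -> V -> R) x : (forall l, Ck 1 (F l)) -> x != 0 ->
  dr (fun y => \sum_l F l y) x = \sum_l dr (F l) x.
Proof.
move=> cF x0; elim: m F cF => [|m IH] F cF.
  rewrite big_ord0 -[RHS](dr_cst 0 x); apply: eq_dr => // y _.
  by rewrite big_ord0.
rewrite big_ord_recr /= -IH // -drD //; last exact: Ck_sum.
by apply: eq_dr => // y _; rewrite big_ord_recr.
Qed.

Lemma Ck_dr k f : Ck k.+1 f -> Ck k (dr f).
Proof.
by move=> cf; apply: Ck_sum => i; apply: CkM; [exact: Ck_unitc|exact: Ck_pd].
Qed.

Lemma Ck_Top_coef k a : Ck k (fun x => (n%:R - 2 - a) / (2 * rad x)).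
Proof.
apply: eq_Ck (CkZ ((n%:R - 2 - a) / 2) (Ck_radV k)) => y _.
by rewrite invfM mulrA.
Qed.

Lemma Ck_Top k a f : Ck k.+1 f -> Ck k (Top a f).
Proof.
move=> cf; apply: CkD; first exact: Ck_dr.
by apply: CkM; [exact: Ck_Top_coef|exact: CkS].
Qed.

Lemma Ck_Lop k j f : Ck k.+1 f -> Ck k (Lop j f).
Proof.
move=> cf; apply: CkB; first exact: Ck_pd.
by apply: CkM; [exact: Ck_unitc|exact: Ck_dr].
Qed.

Lemma Ck_Lapr k f : Ck k.+2 f -> Ck k (Lapr f).
Proof.
move=> cf; apply: CkD; first by do 2!apply: Ck_dr.
apply: CkM; last exact/Ck_dr/CkS.
by apply: CkM; [exact: Ck_cst|exact: Ck_radV].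
Qed.

(** * Functions supported in an annulus around the origin *)

Section Support.
Variables rho M : R.
Hypotheses (rho0 : 0 < rho) (M0 : 0 <= M).

(** Strict inequalities make the region of vanishing open, so derivatives vanish on it too and every
    operator keeps the same [rho] and [M]. Vanishing near 0 neutralises the singular weights and
    supplies the regularity at 0 on which [Ck] is silent. *)
Definition annsupp f := forall x, `|x| < rho \/ M < `|x| -> f x = 0.

Definition Ckann k f := Ck k f /\ annsupp f.

Lemma near_annsupp f x : annsupp f -> `|x| < rho \/ M < `|x| ->
  \forall y \near x, f y = 0.
Proof.
move=> f0 [xr|Mx].
  near=> y; apply: f0; left.
  have h1 : `|x - y| < rho - `|x|.
    by near: y; apply: (@cvgr_dist_lt _ _ _ _ _ id) => //; rewrite subr_gt0.
  by have := ler_normB x (x - y); rewrite opprB addrC subrK; lra.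
near=> y; apply: f0; right.
have h1 : `|x - y| < `|x| - M.
  by near: y; apply: (@cvgr_dist_lt _ _ _ _ _ id) => //; rewrite subr_gt0.
by have := ler_normD (x - y) y; rewrite subrK; lra.
Unshelve. all: by end_near. Qed.

Lemma annsupp_pd j f : annsupp f -> annsupp (pd j f).
Proof.
move=> f0 x /(near_annsupp f0) nf.
have -> : pd j f x = pd j (fun _ : V => 0) x by exact: near_eq_derive.
exact: derive_cst.
Qed.

Lemma annsuppMl w f : annsupp f -> annsupp (fun x => w x * f x).
Proof. by move=> f0 x /f0 ->; rewrite mulr0. Qed.

Lemma annsuppMr w f : annsupp f -> annsupp (fun x => f x * w x).
Proof. by move=> f0 x /f0 ->; rewrite mul0r. Qed.

Lemma annsuppD f g : annsupp f -> annsupp g -> annsupp (fun x => f x + g x).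
Proof. by move=> f0 g0 x hx; rewrite (f0 x hx) (g0 x hx) addr0. Qed.

Lemma annsuppB f g : annsupp f -> annsupp g -> annsupp (fun x => f x - g x).
Proof. by move=> f0 g0 x hx; rewrite (f0 x hx) (g0 x hx) subrr. Qed.

Lemma annsupp_sum m (F : 'I_m -> V -> R) : (forall l, annsupp (F l)) ->
  annsupp (fun x => \sum_l F l x).
Proof. by move=> F0 x hx; rewrite big1 // => l _; exact: F0. Qed.

Lemma annsupp_dr f : annsupp f -> annsupp (dr f).
Proof. by move=> f0; apply: annsupp_sum => i; apply/annsuppMl/annsupp_pd. Qed.

(** This is what lets identities proved off the origin be integrated over the whole space. *)
Lemma annsupp_eq f g : annsupp f -> annsupp g -> (forall x, x != 0 -> f x = g x) ->
  f =1 g.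
Proof.
move=> f0 g0 fg x; have [->|] := eqVneq x 0; last exact: fg.
by rewrite f0 ?g0 ?normr0; auto.
Qed.

Lemma CkannS k f : Ckann k.+1 f -> Ckann k f.
Proof. by move=> [/CkS]. Qed.

Lemma Ckann_pd k j f : Ckann k.+1 f -> Ckann k (pd j f).
Proof. by move=> [cf f0]; split; [exact: Ck_pd|exact: annsupp_pd]. Qed.

Lemma CkannMl k w f : Ck k w -> Ckann k f -> Ckann k (fun x => w x * f x).
Proof. by move=> cw [cf f0]; split; [exact: CkM|exact: annsuppMl]. Qed.

Lemma CkannMr k w f : Ckann k f -> Ck k w -> Ckann k (fun x => f x * w x).
Proof. by move=> [cf f0] cw; split; [exact: CkM|exact: annsuppMr]. Qed.

Lemma CkannM k f g : Ckann k f -> Ckann k g -> Ckann k (fun x => f x * g x).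
Proof. by move=> cf [cg _]; exact: CkannMr. Qed.

Lemma CkannX k f : Ckann k f -> Ckann k (fun x => f x ^+ 2).
Proof. by move=> cf; have := CkannM cf cf. Qed.

Lemma CkannZ k (c : R) f : Ckann k f -> Ckann k (fun x => c * f x).
Proof. by apply: CkannMl; exact: Ck_cst. Qed.

Lemma CkannD k f g : Ckann k f -> Ckann k g -> Ckann k (fun x => f x + g x).
Proof. by move=> [cf f0] [cg g0]; split; [exact: CkD|exact: annsuppD]. Qed.

Lemma CkannB k f g : Ckann k f -> Ckann k g -> Ckann k (fun x => f x - g x).
Proof. by move=> [cf f0] [cg g0]; split; [exact: CkB|exact: annsuppB]. Qed.

Lemma Ckann_sum k m (F : 'I_m -> V -> R) : (forall l, Ckann k (F l)) ->
  Ckann k (fun x => \sum_l F l x).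
Proof.
by move=> cF; split; [apply: Ck_sum => l|apply: annsupp_sum => l]; have [] := cF l.
Qed.

Lemma Ckann_dr k f : Ckann k.+1 f -> Ckann k (dr f).
Proof. by move=> [cf f0]; split; [exact: Ck_dr|exact: annsupp_dr]. Qed.

Lemma Ckann_Top k a f : Ckann k.+1 f -> Ckann k (Top a f).
Proof.
by move=> cf; apply: CkannD; [exact: Ckann_dr|apply: CkannMl; [exact: Ck_Top_coef|exact: CkannS]].
Qed.

Lemma Ckann_Lop k j f : Ckann k.+1 f -> Ckann k (Lop j f).
Proof.
by move=> cf; apply: CkannB; [exact: Ckann_pd|apply: CkannMl; [exact: Ck_unitc|exact: Ckann_dr]].
Qed.

Lemma Ckann_Lap k f : Ckann k.+2 f -> Ckann k (Lap f).
Proof. by move=> cf; apply: Ckann_sum => i; do 2!apply: Ckann_pd. Qed.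

Lemma Ckann_Lapr k f : Ckann k.+2 f -> Ckann k (Lapr f).
Proof.
move=> cf; split; first by case: cf => cf _; exact: Ck_Lapr.
case: cf => _ f0; apply: annsuppD; first by do 2!apply: annsupp_dr.
exact/annsuppMl/annsupp_dr.
Qed.

Lemma Ckann_ccsupp f : Ckann 0 f -> ccsupp M f.
Proof.
move=> [cf f0]; split; last by move=> x Mx; apply: f0; right.
move=> x; have [->|x0] := eqVneq x 0; last exact: (cf x x0).
have n0 : `|0 : V| < rho \/ M < `|0 : V| by left; rewrite normr0.
rewrite /continuous_at (f0 _ n0).
have E : \forall y \near (0 : V), 0 = f y.
  by apply: filterS (near_annsupp f0 n0) => y ->.
exact: (cvg_trans (near_eq_cvg E) (cvg_cst _)).
Qed.

Lemma Ckann_C1csupp f : Ckann 1 f -> C1csupp M f.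
Proof.
move=> cf; split.
- exact/Ckann_ccsupp/CkannS.
- move=> x j; have [->|x0] := eqVneq x 0; last by case: cf => cf _; exact: (Ck_derivable j cf x0).
  have n0 : `|0 : V| < rho \/ M < `|0 : V| by left; rewrite normr0.
  have E : \forall y \near (0 : V), 0 = f y.
    by case: cf => _ f0; apply: filterS (near_annsupp f0 n0) => y ->.
  exact: (near_eq_derivable E (@derivable_cst _ _ _ 0 _ _)).
- by move=> j; apply/Ckann_ccsupp/Ckann_pd.
Qed.

Lemma intRn_annD f g : Ckann 0 f -> Ckann 0 g -> intRn (fun x => f x + g x) = intRn f + intRn g.
Proof. by move=> cf cg; apply: (intRnD M0); exact: Ckann_ccsupp. Qed.

Lemma intRn_annB f g : Ckann 0 f -> Ckann 0 g -> intRn (fun x => f x - g x) = intRn f - intRn g.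
Proof. by move=> cf cg; apply: (intRnB M0); exact: Ckann_ccsupp. Qed.

Lemma intRn_annZ (c : R) f : Ckann 0 f -> intRn (fun x => c * f x) = c * intRn f.
Proof. by move=> cf; apply: (intRnZ _ M0); exact: Ckann_ccsupp. Qed.

Lemma intRn_ann_sum m (F : 'I_m -> V -> R) : (forall l, Ckann 0 (F l)) ->
  intRn (fun x => \sum_l F l x) = \sum_l intRn (F l).
Proof.
elim: m F => [|m IH] F cF.
  have c0 : Ckann 0 (fun _ : V => 0) by split; [exact: Ck_cst|].
  have J0 : intRn (fun _ : V => 0) = 0.
    rewrite -[RHS](mul0r (intRn (fun _ : V => 0))) -(intRn_annZ 0 c0).
    by apply: eq_intRn => x; rewrite mul0r.
  by rewrite big_ord0 -[RHS]J0; apply: eq_intRn => x; rewrite big_ord0.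
rewrite big_ord_recr /= -IH // -intRn_annD //; last exact: Ckann_sum.
by apply: eq_intRn => x; rewrite big_ord_recr.
Qed.

Lemma intRn_ann_pd j f : Ckann 1 f -> intRn (pd j f) = 0.
Proof. by move=> /Ckann_C1csupp; exact: intRn_pd. Qed.

(** The divergence of the radial field f x/r; at [dr f] it gives [Lapr f]. *)
Definition rdiv f x : R := dr f x + (n%:R - 1) / rad x * f x.

Lemma Ckann_rdiv f : Ckann 1 f -> Ckann 0 (rdiv f).
Proof.
move=> cf; apply: CkannD; first exact: Ckann_dr.
apply: CkannMl; last exact: CkannS.
by apply: CkM; [exact: Ck_cst|exact: Ck_radV].
Qed.

Lemma sum_pd_unitcM f x : Ck 1 f -> x != 0 ->
  \sum_i pd i (fun y => th i y * f y) x = rdiv f x.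
Proof.
move=> cf x0; transitivity (\sum_i (th i x * pd i f x +
    (1 - th i x * th i x) * (f x / rad x))).
  apply: eq_bigr => i _.
  rewrite (pdM (Ck_derivable i (Ck_unitc 1 i) x0) (Ck_derivable i cf x0)).
  by rewrite pd_unitc // eqxx mulr1n; ring.
rewrite big_split /= /rdiv; congr (_ + _).
rewrite -mulr_suml sumrB sum_unitc_sqr // sumr_const card_ord.
by rewrite mulrA (mulrAC _ (rad x)^-1).
Qed.

Lemma intRn_rdiv f : Ckann 1 f -> intRn (rdiv f) = 0.
Proof.
move=> cf; have c1 i : Ckann 1 (fun y => th i y * f y).
  by apply: CkannMl => //; exact: Ck_unitc.
transitivity (intRn (fun x => \sum_i pd i (fun y => th i y * f y) x)).
  apply/eq_intRn/annsupp_eq.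
  - by have [] := Ckann_rdiv cf.
  - by apply: annsupp_sum => i; have [] := Ckann_pd i (c1 i).
  - by move=> x x0; rewrite sum_pd_unitcM //; case: cf.
rewrite intRn_ann_sum; last by move=> i; exact: Ckann_pd.
by rewrite big1 // => i _; exact: intRn_ann_pd.
Qed.

End Support.

End Annulus.

(** * Pointwise identities *)

Section Identities.
Variables (R : realType) (n : nat).
Notation V := 'rV[R]_n.
Notation rad := (@Defs.rad R n).
Notation intRn := (@intRn R n).
Notation W := (@radpow R n).
Notation th := (@unitc R n).
Implicit Types (f g u v : V -> R) (x y : V) (a c p : R) (i j : 'I_n) (k : nat).

Lemma wnorm2E p g : wnorm2 p g = intRn (fun x => g x ^+ 2 * W (- p) x).
Proof.
by rewrite /wnorm2 /intRn; congr (fine (iint _ _)); apply/funext => s; rewrite real_normK // num_real.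
Qed.

Lemma dr_weighted c p u v x : Ck 1 u -> Ck 1 v -> x != 0 ->
  dr (fun y => c * (u y * v y * W p y)) x =
  c * ((u x * dr v x + v x * dr u x) * W p x + u x * v x * (p * W p x / rad x)).
Proof.
move=> cu cv x0; have cuv := CkM cu cv; have cw := Ck_radpow n 1 p.
rewrite (drZ c (CkM cuv cw) x0).
by rewrite (drM cuv cw x0) (drM cu cv x0) dr_radpow //; ring.
Qed.

Lemma Ck_weighted k c p u v : Ck k u -> Ck k v ->
  Ck k (fun y => c * (u y * v y * W p y)).
Proof. by move=> cu cv; apply/CkZ/CkM; [exact: CkM|exact: Ck_radpow]. Qed.

(** With g = T_(a+2) f and h = T_a g, the radial divergences of g^2 r^(-a-1), g f r^(-a-2) and f^2
    r^(-a-3) are 2 g h r^(-a-1), (h f + g^2) r^(-a-2) and 2 f g r^(-a-3). The coefficients match the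
    mixed products in the square of h + (a+2) g/r - A_a f/r^2; the g^2 in the second divergence
    accounts for the 2 A_a in D_a. *)
Definition radial_flux a f : V -> R := fun y =>
  (a + 2) * (Top (a + 2) f y * Top (a + 2) f y * W (- a - 1) y)
  + - (2 * Acoef n a) * (Top (a + 2) f y * f y * W (- a - 1 - 1) y)
  + - (Acoef n a * (a + 2)) * (f y * f y * W (- a - 1 - 1 - 1) y).

Lemma radial_identity a f x : Ck 2 f -> x != 0 ->
  Lapr f x ^+ 2 * W (- a) x =
  Rop a f x ^+ 2 * W (- a) x
  + Dcoef n a * (Top (a + 2) f x ^+ 2 * W (- (a + 2)) x)
  + Acoef n a ^+ 2 * (f x ^+ 2 * W (- (a + 4)) x)
  + rdiv (radial_flux a f) x.
Proof.
move=> cf x0; have r0 := lt0r_neq0 (rad_gt0 x0).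
have cg : Ck 1 (Top (a + 2) f) by exact: Ck_Top.
have cf1 : Ck 1 f by exact: CkS.
have cdf : Ck 1 (dr f) by exact: Ck_dr.
pose b := (n%:R - 2 - (a + 2)) / 2.
have gE : Top (a + 2) f x = dr f x + b / rad x * f x.
  by rewrite /Top /b; congr (_ + _ * _); rewrite invfM mulrA.
have dgE : dr (Top (a + 2) f) x =
    dr (dr f) x + b * (dr f x / rad x - f x / rad x ^+ 2).
  rewrite (@eq_dr _ _ _ (fun y => dr f y + b * (f y * W (-1) y))) //; last first.
    by move=> y _; rewrite /Top radpowN1 /b invfM; congr (_ + _); ring.
  have cw := Ck_radpow n 1 (-1 : R).
  have cfw := CkM cf1 cw.
  rewrite (drD cdf (CkZ b cfw) x0) (drZ b cfw x0) (drM cf1 cw x0) dr_radpow // radpowN1; congr (_ + _ * _).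
  by field.
have c1 := Ck_weighted (a + 2) (- a - 1) cg cg.
have c2 := Ck_weighted (- (2 * Acoef n a)) (- a - 1 - 1) cg cf1.
have c3 := Ck_weighted (- (Acoef n a * (a + 2))) (- a - 1 - 1 - 1) cf1 cf1.
rewrite /rdiv /radial_flux (drD (CkD c1 c2) c3 x0) (drD c1 c2 x0).
rewrite (dr_weighted _ _ cg cg x0) (dr_weighted _ _ cg cf1 x0) (dr_weighted _ _ cf1 cf1 x0).
(* Exponents become repeated subtractions of 1, so that [radpowB1] leaves a single power r^(-a) over
   powers of r and the goal is a field identity. *)
rewrite (_ : - (a + 4) = - a - 1 - 1 - 1 - 1); last by ring.
rewrite (_ : - (a + 2) = - a - 1 - 1); last by ring.
rewrite !radpowB1 // /Rop [Top a _ x]/Top /Lapr dgE gE /Dcoef /Acoef /b.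
by field.
Qed.

(** Here L, dL, v', t, q stand for L_j, d_r L_j, d_r^2 f, x_j/r and d_j d_r f. Modulo t, the terms
    without T_a and A_a come from - (dL + L/r)(dL - (1+a) L/r) w. Its product L dL has coefficient -
    a inside the form, against n - 2 - a in (T_a L)^2: this fixes the factor (n-2)/2 of the radial
    divergence. The L^2 left over has coefficient ((n-2)^2 - (a+2)^2)/4 = A_a. The right side holds
    only t dL and t L, which sum to zero over j. *)
Lemma cross_term_algebra (N a r w w1 w2 L dL v' t q T : R) : r != 0 ->
  q = dL + t * v' + L / r ->
  T = 1 * ((L * dL + L * dL) * w1 + L * L * ((- a - 1) * w1 / r)) ->
  w1 = w / r -> w2 = w / r / r ->
  (dL + (N - 2 - a) / (2 * r) * L) ^+ 2 * w
   + (N + a) * (N - 4 - a) / 4 * (L ^+ 2 * w2) + w / r * (L * q)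
   - q * (w * dL + L * (w / r) * (N - 1 - a)) + (N - 1) * (w / r * (L * q))
   + - ((N - 2) / 2) * (T + (N - 1) / r * (1 * (L * L * w1))) =
  - (v' * w) * (t * dL) + v' * (1 + a) * w / r * (t * L).
Proof. by move=> r0 -> -> -> ->; field. Qed.

(** S1 and P are solved for w v' D and w v D / r; the last hypothesis gathers the tangential
    remainder. *)
Lemma cross_close (v' v D w r s1 s2 s3 s4 s5 A k m S1 S2 P : R) :
  S1 = w * v' * D + w / r * s3 -> S2 = s4 -> P = w / r * (v * D + s3) ->
  s1 + A * s2 + w / r * s3 - s4 + k * (w / r * s3) + - m * s5 = 0 ->
  (v' + k / r * v) * D * w = s1 + A * s2 + (S1 - S2) + k * P + - m * s5.
Proof.
move=> -> -> -> H; rewrite -[LHS]addr0 -[X in _ + X]H; ring.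
Qed.

Section Sums.
Variables (t L q d : 'I_n -> R) (P : 'I_n -> 'I_n -> R) (w r a : R).

(** Since L is orthogonal to the unit radial vector t, the derivatives of r^(-a) and the part t_i
    t_j of the derivative of t_i drop out; only the Kronecker part survives. *)
Lemma swap_sum1 : \sum_j t j * L j = 0 ->
  \sum_i \sum_j (t i * w * d j + L j * (t i * (- a * w / r * t j)
     + w * (((i == j)%:R - t i * t j) / r))) * q i =
  w * (\sum_i t i * q i) * (\sum_j d j) + w / r * \sum_j L j * q j.
Proof.
move=> tL; transitivity (\sum_i (w * (\sum_j d j) * (t i * q i) + w / r * (L i * q i))).
  apply: eq_bigr => i _.
  transitivity (\sum_j (w * t i * q i * d j - (1 + a) * w / r * t i * q i * (t j * L j)
      + w / r * q i * ((i == j)%:R * L j))).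
    by apply: eq_bigr => j _; ring.
  rewrite big_split sumrB /= -!mulr_sumr tL mulr0 subr0.
  have -> : \sum_j (i == j)%:R * L j = L i.
    rewrite (bigD1 i) //= eqxx mul1r big1 ?addr0 // => j ji.
    by rewrite eq_sym (negbTE ji) mul0r.
  by ring.
by rewrite big_split -!mulr_sumr /=; ring.
Qed.

(** The factor n - 1 - a comes from the divergence of r^(-a) x/r. *)
Lemma swap_sum2 : \sum_j t j * t j = 1 ->
  \sum_i \sum_j (t i * w * P i j + L j * (t i * (- a * w / r * t i)
     + w * ((1 - t i * t i) / r))) * q j =
  \sum_j q j * (w * (\sum_i t i * P i j) + L j * (w / r) * (n%:R - 1 - a)).
Proof.
move=> tt; rewrite exchange_big /=; apply: eq_bigr => j _.
transitivity (\sum_i (q j * w * (t i * P i j) + q j * L j * (w / r)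
    - (1 + a) * (q j * L j * (w / r)) * (t i * t i))).
  by apply: eq_bigr => i _; ring.
rewrite sumrB big_split /= -!mulr_sumr tt sumr_const card_ord -mulr_natr; ring.
Qed.

End Sums.

Lemma sum_unitc_Lop f x : x != 0 -> \sum_j th j x * Lop j f x = 0.
Proof.
move=> x0; transitivity (\sum_j (th j x * pd j f x - dr f x * (th j x * th j x))).
  by apply: eq_bigr => j _; rewrite /Lop -/(th j x); ring.
by rewrite sumrB -mulr_sumr sum_unitc_sqr // mulr1 /dr subrr.
Qed.

(** Orthogonality of L and x is differentiated along a ray, on which x/r is constant. *)
Lemma sum_unitc_dr_Lop f x : Ck 2 f -> x != 0 -> \sum_j th j x * dr (Lop j f) x = 0.
Proof.
move=> cf x0; have cL j : Ck 1 (Lop j f) by exact: Ck_Lop.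
have ct j : Ck 1 (th j) by exact: Ck_unitc.
transitivity (dr (fun y => \sum_j th j y * Lop j f y) x).
  rewrite (dr_sum (fun j => CkM (ct j) (cL j)) x0).
  by apply: eq_bigr => j _; rewrite (drM (ct j) (cL j) x0) dr_unitc // mulr0 addr0.
rewrite -[RHS](dr_cst 0 x); apply: eq_dr => // y y0.
exact: sum_unitc_Lop.
Qed.

(** The gradient splits into the L_j and the radial field (d_r f) x/r, whose divergence is Delta_r
    f. *)
Lemma LapB_Lapr f x : Ck 2 f -> x != 0 ->
  Lap f x - Lapr f x = \sum_j pd j (Lop j f) x.
Proof.
move=> cf x0; have cdf : Ck 1 (dr f) by exact: Ck_dr.
have -> : Lapr f x = rdiv (dr f) x by [].
rewrite -(sum_pd_unitcM cdf x0) /Lap -sumrB; apply: eq_bigr => j _.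
have cp : Ck 1 (pd j f) by exact: Ck_pd.
have ct := CkM (Ck_unitc R 1 j) cdf; have cN := CkZ (-1) ct.
transitivity (pd j (fun y => pd j f y + (-1) * (th j y * dr f y)) x); last first.
  by apply: eq_pd => // y _; rewrite mulN1r.
rewrite (pdD (Ck_derivable j cp x0) (Ck_derivable j cN x0)).
rewrite (pdM (Ck_derivable j (Ck_cst n 1 (-1 : R)) x0) (Ck_derivable j ct x0)).
have -> : pd j (fun _ : V => -1) x = 0 by exact: derive_cst.
by rewrite mulr0 addr0 mulN1r.
Qed.

Lemma pd_sum m (F : 'I_m -> V -> R) x j : (forall l, Ck 1 (F l)) -> x != 0 ->
  pd j (fun y => \sum_l F l y) x = \sum_l pd j (F l) x.
Proof.
move=> cF x0; elim: m F cF => [|m IH] F cF.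
  rewrite big_ord0 (@eq_pd _ _ _ (fun _ => 0)) //; first exact: derive_cst.
  by move=> y _; rewrite big_ord0.
have cS : Ck 1 (fun y => \sum_(l < m) F (widen_ord (leqnSn m) l) y) by exact: Ck_sum.
rewrite big_ord_recr /= -IH // -(pdD (Ck_derivable j cS x0) (Ck_derivable j (cF _) x0)).
by apply: eq_pd => // y _; rewrite big_ord_recr.
Qed.

(** The Hessian contracted with x/r gives the first two terms, by symmetry of second derivatives and
    constancy of x/r along rays; the derivative of x/r gives L_j / r. *)
Lemma pd_dr f x j : Ck 2 f -> x != 0 ->
  pd j (dr f) x = dr (Lop j f) x + th j x * dr (dr f) x + Lop j f x / rad x.
Proof.
move=> cf x0; have cp i : Ck 1 (pd i f) by exact: Ck_pd.
have ct i : Ck 1 (th i) by exact: Ck_unitc.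
have cdf : Ck 1 (dr f) by exact: Ck_dr.
have E1 : pd j (dr f) x = \sum_i (th i x * pd j (pd i f) x
    + pd i f x * (((i == j)%:R - th i x * th j x) / rad x)).
  rewrite {1}/dr (pd_sum j (fun i => CkM (ct i) (cp i)) x0).
  apply: eq_bigr => i _.
  rewrite (pdM (Ck_derivable j (ct i) x0) (Ck_derivable j (cp i) x0)).
  by rewrite pd_unitc.
have E2 : dr (Lop j f) x = \sum_i th i x * pd j (pd i f) x - th j x * dr (dr f) x.
  have cM := CkM (ct j) cdf; have cN := CkZ (-1) cM.
  rewrite (@eq_dr _ _ _ (fun y => pd j f y + (-1) * (th j y * dr f y))) //; last first.
    by move=> y _; rewrite mulN1r.
  have H1 := drD (cp j) cN x0.
  have H2 := drZ (-1) cM x0.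
  have H3 := drM (ct j) cdf x0.
  have H4 : dr (pd j f) x = \sum_i th i x * pd j (pd i f) x.
    by apply: eq_bigr => i _; rewrite (pdC i j cf x0).
  move: H3; rewrite (dr_unitc j x0) mulr0 addr0 => H3.
  move: H2; rewrite H3 mulN1r => H2.
  move: H1; rewrite H4 H2 => H1.
  exact: H1.
rewrite E1 E2 subrK big_split /=; congr (_ + _).
transitivity (\sum_i ((i == j)%:R * pd i f x - th j x * (th i x * pd i f x)) / rad x).
  by apply: eq_bigr => i _; ring.
rewrite -mulr_suml sumrB -mulr_sumr (bigD1 j) //= eqxx mul1r big1 ?addr0 //.
by move=> i ij; rewrite (negbTE ij) mul0r.
Qed.

Definition swap_field a f i j : V -> R := fun y => th i y * W (- a) y * Lop j f y.
Definition mixed_flux a f j : V -> R := fun y => W (- a - 1) y * (dr f y * Lop j f y).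
(** The factor 1 gives the expression the shape required by [dr_weighted]. *)
Definition tangential_flux a f j : V -> R :=
  fun y => 1 * (Lop j f y * Lop j f y * W (- a - 1) y).

Lemma pd_swap_field a f x i j l : Ck 2 f -> x != 0 ->
  pd l (swap_field a f i j) x = th i x * W (- a) x * pd l (Lop j f) x
  + Lop j f x * (th i x * (- a * W (- a) x / rad x * th l x)
     + W (- a) x * (((i == l)%:R - th i x * th l x) / rad x)).
Proof.
move=> cf x0; have cL : Ck 1 (Lop j f) by exact: Ck_Lop.
have ct : Ck 1 (th i) by exact: Ck_unitc.
have cw := Ck_radpow n 1 (- a).
rewrite (pdM (Ck_derivable l (CkM ct cw) x0) (Ck_derivable l cL x0)).
rewrite (pdM (Ck_derivable l ct x0) (Ck_derivable l cw x0)).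
by rewrite pd_unitc // pd_radpow_unitc.
Qed.

Lemma pd_mixed_flux a f x j : Ck 2 f -> x != 0 ->
  pd j (mixed_flux a f j) x = W (- a) x / rad x *
    (dr f x * pd j (Lop j f) x + Lop j f x * pd j (dr f) x
     - (a + 1) / rad x * dr f x * (th j x * Lop j f x)).
Proof.
move=> cf x0; have cL : Ck 1 (Lop j f) by exact: Ck_Lop.
have cdf : Ck 1 (dr f) by exact: Ck_dr.
have cw := Ck_radpow n 1 (- a - 1).
rewrite (pdM (Ck_derivable j cw x0) (Ck_derivable j (CkM cdf cL) x0)).
rewrite (pdM (Ck_derivable j cdf x0) (Ck_derivable j cL x0)).
rewrite pd_radpow_unitc // radpowB1 //; ring.
Qed.

Lemma cross_term a f x j : Ck 2 f -> x != 0 ->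
  Top a (Lop j f) x ^+ 2 * W (- a) x
   + Acoef n a * (Lop j f x ^+ 2 * W (- (a + 2)) x)
   + W (- a) x / rad x * (Lop j f x * pd j (dr f) x)
   - pd j (dr f) x * (W (- a) x * dr (Lop j f) x
       + Lop j f x * (W (- a) x / rad x) * (n%:R - 1 - a))
   + (n%:R - 1) * (W (- a) x / rad x * (Lop j f x * pd j (dr f) x))
   + - ((n%:R - 2) / 2) * rdiv (tangential_flux a f j) x =
  - (dr (dr f) x * W (- a) x) * (th j x * dr (Lop j f) x)
      + dr (dr f) x * (1 + a) * W (- a) x / rad x * (th j x * Lop j f x).
Proof.
move=> cf x0; have r0 := lt0r_neq0 (rad_gt0 x0).
have cL : Ck 1 (Lop j f) by exact: Ck_Lop.
have TE := dr_weighted 1 (- a - 1) cL cL x0.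
have vE := pd_dr j cf x0.
have w1 : W (- a - 1) x = W (- a) x / rad x by exact: radpowB1.
have w2 : W (- (a + 2)) x = W (- a) x / rad x / rad x.
  by rewrite (_ : - (a + 2) = - a - 1 - 1) ?radpowB1 //; ring.
rewrite /Top /Acoef /rdiv.
exact: (@cross_term_algebra n%:R _ _ _ _ _ _ _ _ _ _ _ r0 vE TE w1 w2).
Qed.

Lemma cross_identity a f x : Ck 2 f -> x != 0 ->
  Lapr f x * (Lap f x - Lapr f x) * W (- a) x =
  \sum_j Top a (Lop j f) x ^+ 2 * W (- a) x
  + Acoef n a * \sum_j Lop j f x ^+ 2 * W (- (a + 2)) x
  + (\sum_i \sum_j pd j (swap_field a f i j) x * pd i (dr f) x
     - \sum_i \sum_j pd i (swap_field a f i j) x * pd j (dr f) x)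
  + (n%:R - 1) * \sum_j pd j (mixed_flux a f j) x
  + - ((n%:R - 2) / 2) * \sum_j rdiv (tangential_flux a f j) x.
Proof.
move=> cf x0; have r0 := lt0r_neq0 (rad_gt0 x0).
have cL j : Ck 1 (Lop j f) by exact: Ck_Lop.
have FL := sum_unitc_Lop f x0; have FD := sum_unitc_dr_Lop cf x0.
rewrite (LapB_Lapr cf x0).
have S1E : \sum_i \sum_j pd j (swap_field a f i j) x * pd i (dr f) x =
   W (- a) x * dr (dr f) x * (\sum_j pd j (Lop j f) x)
   + W (- a) x / rad x * \sum_j Lop j f x * pd j (dr f) x.
  apply: etrans (swap_sum1 (fun i => pd i (dr f) x) (fun j => pd j (Lop j f) x)
    (W (- a) x) (rad x) a FL).
  by apply: eq_bigr => i _; apply: eq_bigr => j _; rewrite (pd_swap_field a i j j cf x0).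
have S2E : \sum_i \sum_j pd i (swap_field a f i j) x * pd j (dr f) x =
   \sum_j pd j (dr f) x * (W (- a) x * dr (Lop j f) x
      + Lop j f x * (W (- a) x / rad x) * (n%:R - 1 - a)).
  apply: etrans (swap_sum2 (fun j => Lop j f x) (fun j => pd j (dr f) x)
    (fun i j => pd i (Lop j f) x) (W (- a) x) (rad x) a (sum_unitc_sqr x0)).
  apply: eq_bigr => i _; apply: eq_bigr => j _.
  by rewrite (pd_swap_field a i j i cf x0) eqxx mulr1n.
have PE : \sum_j pd j (mixed_flux a f j) x = W (- a) x / rad x *
    (dr f x * (\sum_j pd j (Lop j f) x) + \sum_j Lop j f x * pd j (dr f) x).
  transitivity (\sum_j W (- a) x / rad x *
    (dr f x * pd j (Lop j f) x + Lop j f x * pd j (dr f) x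
     - (a + 1) / rad x * dr f x * (th j x * Lop j f x))).
    by apply: eq_bigr => j _; exact: pd_mixed_flux.
  by rewrite -mulr_sumr sumrB big_split /= -!mulr_sumr FL mulr0 subr0.
(* The identity holds only after summation: each summand is a combination of x_j L_j and x_j d_r
   L_j. *)
have key : \sum_j (Top a (Lop j f) x ^+ 2 * W (- a) x
   + Acoef n a * (Lop j f x ^+ 2 * W (- (a + 2)) x)
   + W (- a) x / rad x * (Lop j f x * pd j (dr f) x)
   - pd j (dr f) x * (W (- a) x * dr (Lop j f) x
       + Lop j f x * (W (- a) x / rad x) * (n%:R - 1 - a))
   + (n%:R - 1) * (W (- a) x / rad x * (Lop j f x * pd j (dr f) x))
   + - ((n%:R - 2) / 2) * rdiv (tangential_flux a f j) x) = 0.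
  transitivity (\sum_j (- (dr (dr f) x * W (- a) x) * (th j x * dr (Lop j f) x)
      + dr (dr f) x * (1 + a) * W (- a) x / rad x * (th j x * Lop j f x))); last first.
    by rewrite big_split -!mulr_sumr /= FL FD !mulr0 addr0.
  apply: eq_bigr => j _; exact: cross_term.
apply: (cross_close S1E S2E PE); rewrite -[RHS]key.
rewrite [RHS]big_split /=; congr (_ + _); last by rewrite mulr_sumr.
rewrite [RHS]big_split /=; congr (_ + _); last by rewrite !mulr_sumr.
rewrite [RHS]sumrB; congr (_ - _).
rewrite [RHS]big_split /=; congr (_ + _); last by rewrite mulr_sumr.
by rewrite [RHS]big_split /=; congr (_ + _); rewrite mulr_sumr.
Qed.

End Identities.

(** * The Rellich identity *)

Section Rellich.
Variables (R : realType) (n : nat) (rho M : R).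
Hypotheses (rho0 : 0 < rho) (M0 : 0 <= M).
Notation V := 'rV[R]_n.
Notation intRn := (@intRn R n).
Notation W := (@radpow R n).
Notation Ckann := (@Ckann R n rho M).
Implicit Types (f g u : V -> R) (a p : R) (i j : 'I_n) (k : nat).

Lemma Ckann_sqr_weight g p : Ckann 0 g -> Ckann 0 (fun x => g x ^+ 2 * W p x).
Proof. by move=> cg; apply: CkannMr; [exact: CkannX|exact: Ck_radpow]. Qed.

Lemma Ckann_radial_flux a f : Ckann 2 f -> Ckann 1 (radial_flux a f).
Proof.
move=> cf; have cg := Ckann_Top (a + 2) cf; have cf1 := CkannS cf.
have cw c p g h : Ckann 1 g -> Ckann 1 h -> Ckann 1 (fun y => c * (g y * h y * W p y)).
  by move=> cg' ch; apply: CkannZ; apply: CkannMr; [exact: CkannM|exact: Ck_radpow].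
by apply: CkannD; [apply: CkannD|]; exact: cw.
Qed.

Lemma wnorm2_Lapr a f : Ckann 2 f ->
  wnorm2 a (Lapr f) = wnorm2 a (Rop a f)
    + Dcoef n a * wnorm2 (a + 2) (Top (a + 2) f)
    + Acoef n a ^+ 2 * wnorm2 (a + 4) f.
Proof.
move=> cf; rewrite !wnorm2E.
have cF := Ckann_radial_flux a cf.
have cd := Ckann_rdiv cF.
have c0 := Ckann_sqr_weight (- a) (Ckann_Lapr cf).
have c1 := Ckann_sqr_weight (- a) (Ckann_Top a (Ckann_Top (a + 2) cf)).
have c2 := CkannZ (Dcoef n a) (Ckann_sqr_weight (- (a + 2)) (CkannS (Ckann_Top (a + 2) cf))).
have c3 := CkannZ (Acoef n a ^+ 2) (Ckann_sqr_weight (- (a + 4)) (CkannS (CkannS cf))).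
have E := annsupp_eq rho0 (proj2 c0) (proj2 (CkannD (CkannD (CkannD c1 c2) c3) cd))
  (fun x x0 => radial_identity a (proj1 cf) x0).
rewrite (eq_intRn E) (intRn_annD rho0 M0 (CkannD (CkannD c1 c2) c3) cd).
rewrite (intRn_annD rho0 M0 (CkannD c1 c2) c3) (intRn_annD rho0 M0 c1 c2).
rewrite (intRn_rdiv rho0 M0 cF) addr0; congr (_ + _ + _).
  exact: (intRn_annZ rho0 M0 _ (Ckann_sqr_weight _ (CkannS (Ckann_Top (a + 2) cf)))).
exact: (intRn_annZ rho0 M0 _ (Ckann_sqr_weight _ (CkannS (CkannS cf)))).
Qed.

Lemma intRn_Lapr_LapB a f : Ckann 2 f ->
  intRn (fun x => Lapr f x * (Lap f x - Lapr f x) * W (- a) x) =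
  \sum_j wnorm2 a (Top a (Lop j f)) + Acoef n a * \sum_j wnorm2 (a + 2) (Lop j f).
Proof.
move=> cf; have cv := Ckann_dr cf.
have cL j : Ckann 1 (Lop j f) by exact: Ckann_Lop.
have cs i j : Ckann 1 (swap_field a f i j).
  apply: CkannMl; last exact: cL.
  by apply: CkM; [exact: Ck_unitc|exact: Ck_radpow].
have cm j : Ckann 1 (mixed_flux a f j).
  by apply: CkannMl; [exact: Ck_radpow|exact: (CkannM cv (cL j))].
have ct j : Ckann 1 (tangential_flux a f j).
  by apply: CkannZ; apply: CkannMr; [exact: (CkannM (cL j) (cL j))|exact: Ck_radpow].
have c0 : Ckann 0 (fun x => Lapr f x * (Lap f x - Lapr f x) * W (- a) x).
  apply: CkannMr; last exact: Ck_radpow.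
  exact: (CkannM (Ckann_Lapr cf) (CkannB (Ckann_Lap cf) (Ckann_Lapr cf))).
have cT j := Ckann_sqr_weight (- a) (Ckann_Top a (cL j)).
have cQ j := Ckann_sqr_weight (- (a + 2)) (CkannS (cL j)).
have c1 := Ckann_sum cT.
have c2 := Ckann_sum cQ.
have cS1 i j : Ckann 0 (fun x => pd j (swap_field a f i j) x * pd i (dr f) x).
  exact: (CkannM (Ckann_pd j (cs i j)) (Ckann_pd i cv)).
have cS2 i j : Ckann 0 (fun x => pd i (swap_field a f i j) x * pd j (dr f) x).
  exact: (CkannM (Ckann_pd i (cs i j)) (Ckann_pd j cv)).
have cS1' := Ckann_sum (fun i => Ckann_sum (cS1 i)).
have cS2' := Ckann_sum (fun i => Ckann_sum (cS2 i)).
have cm' := Ckann_sum (fun j => Ckann_pd j (cm j)).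
have ct' := Ckann_sum (fun j => Ckann_rdiv (ct j)).
have c12 := CkannD c1 (CkannZ (Acoef n a) c2).
have cB := CkannB cS1' cS2'.
have c3 := CkannZ (n%:R - 1) cm'.
have c4 := CkannZ (- ((n%:R - 2) / 2)) ct'.
have JS i : intRn (fun x => \sum_j pd j (swap_field a f i j) x * pd i (dr f) x) =
    intRn (fun x => \sum_j pd i (swap_field a f i j) x * pd j (dr f) x).
  apply: (etrans (intRn_ann_sum rho0 M0 (cS1 i))).
  apply: (etrans _ (esym (intRn_ann_sum rho0 M0 (cS2 i)))).
  apply: eq_bigr => j _.
  exact: (intRn_pd_swap j i M0 (Ckann_C1csupp rho0 (cs i j)) (Ckann_C1csupp rho0 cv)).
have JB0 : intRn (fun x => \sum_i \sum_j pd j (swap_field a f i j) x * pd i (dr f) x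
     - \sum_i \sum_j pd i (swap_field a f i j) x * pd j (dr f) x) = 0.
  apply: (etrans (intRn_annB rho0 M0 cS1' cS2')); apply/eqP; rewrite subr_eq0; apply/eqP.
  apply: (etrans (intRn_ann_sum rho0 M0 (fun i => Ckann_sum (cS1 i)))).
  apply: (etrans _ (esym (intRn_ann_sum rho0 M0 (fun i => Ckann_sum (cS2 i))))).
  by apply: eq_bigr => i _; exact: JS.
have E := annsupp_eq rho0 (proj2 c0) (proj2 (CkannD (CkannD (CkannD c12 cB) c3) c4))
  (fun x x0 => cross_identity a (proj1 cf) x0).
rewrite (eq_intRn E) (intRn_annD rho0 M0 (CkannD (CkannD c12 cB) c3) c4).
rewrite (intRn_annD rho0 M0 (CkannD c12 cB) c3) (intRn_annD rho0 M0 c12 cB).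
rewrite (intRn_annZ rho0 M0 _ cm') (intRn_annZ rho0 M0 _ ct').
rewrite (intRn_annD rho0 M0 c1 (CkannZ (Acoef n a) c2)) (intRn_annZ rho0 M0 _ c2).
rewrite (intRn_ann_sum rho0 M0 (fun j => Ckann_pd j (cm j))) big1; last first.
  by move=> j _; exact: (intRn_ann_pd rho0 M0 j (cm j)).
rewrite (intRn_ann_sum rho0 M0 (fun j => Ckann_rdiv (ct j))) big1; last first.
  by move=> j _; exact: (intRn_rdiv rho0 M0 (ct j)).
rewrite JB0 !mulr0 !addr0 (intRn_ann_sum rho0 M0 cT) (intRn_ann_sum rho0 M0 cQ).
by congr (_ + _ * _); apply: eq_bigr => j _; rewrite wnorm2E.
Qed.

Lemma Rellich_identity a f : Ckann 2 f ->
  wnorm2 a (Lap f) = Acoef n a ^+ 2 * wnorm2 (a + 4) f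
   + (Dcoef n a * wnorm2 (a + 2) (Top (a + 2) f) + wnorm2 a (Rop a f)
      + wnorm2 a (fun x => Lap f x - Lapr f x)
      + 2 * \sum_j wnorm2 a (Top a (Lop j f))
      + 2 * Acoef n a * \sum_j wnorm2 (a + 2) (Lop j f)).
Proof.
move=> cf.
have c1 := Ckann_sqr_weight (- a) (Ckann_Lapr cf).
have cD := CkannB (Ckann_Lap cf) (Ckann_Lapr cf).
have c2 := Ckann_sqr_weight (- a) cD.
have c3 : Ckann 0 (fun x => Lapr f x * (Lap f x - Lapr f x) * W (- a) x).
  by apply: CkannMr (Ck_radpow n 0 (- a)); exact: (CkannM (Ckann_Lapr cf) cD).
(* The square of Lap f = Lapr f + (Lap f - Lapr f) is expanded under the integral. *)
have : wnorm2 a (Lap f) = wnorm2 a (Lapr f) + wnorm2 a (fun x => Lap f x - Lapr f x)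
    + 2 * intRn (fun x => Lapr f x * (Lap f x - Lapr f x) * W (- a) x).
  rewrite !wnorm2E -(intRn_annZ rho0 M0 _ c3) -(intRn_annD rho0 M0 c1 c2).
  rewrite -(intRn_annD rho0 M0 (CkannD c1 c2) (CkannZ 2 c3)).
  by apply: eq_intRn => x; ring.
rewrite (wnorm2_Lapr a cf) (intRn_Lapr_LapB a cf) => ->; ring.
Qed.

Lemma Ckann_leq k l u : (k <= l)%N -> Ckann l u -> Ckann k u.
Proof.
move=> kl; rewrite -(subnK kl); elim: (l - k)%N => [//|d IH] cu.
by apply: IH; apply: CkannS; rewrite addSn in cu.
Qed.

Lemma Ckann_iter_Lap k l u : Ckann (2 * l + k) u -> Ckann k (iter l (@Lap R n) u).
Proof.
elim: l k => [//|l IH] k cu; rewrite iterS; apply: Ckann_Lap; apply: IH.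
by move: cu; rewrite mulnS addnC addnA addnC addn2.
Qed.

End Rellich.

Lemma csupp_away0_annsupp (R : realType) n (u : 'rV[R]_n -> R) : csupp_away0 u ->
  exists rho M : R, [/\ 0 < rho, 0 <= M & annsupp rho M u].
Proof.
set S := [set x | u x != 0] => -[cS S0].
have uS x : ~ closure S x -> u x = 0.
  by move=> nS; apply/eqP; apply: contra_notT nS => ux; exact: subset_closure.
have /nbhs_normP[rho /= rho0 rhoP] : nbhs (0 : 'rV[R]_n) (~` closure S).
  by apply: open_nbhs_nbhs; split => //; apply: closed_openC; exact: closed_closure.
have [B [_ BS]] := compact_bounded cS.
(* Compactness bounds the support by every number above B; this one is also nonnegative. *)
exists rho, (`|B| + 1); split => // x [xr|Bx].
- by apply: uS; apply: rhoP => /=; rewrite sub0r normrN.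
- apply: uS => Sx; move: Bx; apply/negP; rewrite -leNgt; apply: BS => //.
  by rewrite (le_lt_trans (ler_norm B)) // ltrDl.
Qed.

Theorem theorem1p2 (R : realType) (n m : nat) (alpha : R) (u : 'rV[R]_n -> R) :
  (1 <= n)%N -> (1 <= m)%N -> Ck (2 * m) u -> csupp_away0 u ->
  wnorm2 alpha (iter m (@Lap R n) u) =
    Hm1 n m alpha * wnorm2 (alpha + 4 * m%:R) u +
    \sum_(1 <= k < m.+1)
      Hm1 n k.-1 alpha *
      (Dcoef n (alpha + 4 * k%:R - 4) *
         wnorm2 (alpha + 4 * k%:R - 2) (Top (alpha + 4 * k%:R - 2) (iter (m - k) (@Lap R n) u))
       + wnorm2 (alpha + 4 * k%:R - 4) (Rop (alpha + 4 * k%:R - 4) (iter (m - k) (@Lap R n) u))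
       + wnorm2 (alpha + 4 * k%:R - 4)
           (fun x => Lap (iter (m - k) (@Lap R n) u) x - Lapr (iter (m - k) (@Lap R n) u) x)
       + 2 * \sum_(j < n) wnorm2 (alpha + 4 * k%:R - 4)
                (Top (alpha + 4 * k%:R - 4) (Lop j (iter (m - k) (@Lap R n) u)))
       + 2 * Acoef n (alpha + 4 * k%:R - 4) *
           \sum_(j < n) wnorm2 (alpha + 4 * k%:R - 2) (Lop j (iter (m - k) (@Lap R n) u))).
Proof.
move=> _ _ cu /csupp_away0_annsupp[rho [M [rho0 M0 u0]]].
have cU : Ckann rho M (2 * m) u by [].
set F := BIG_F.
(* Induction on the number p of Laplacians removed so far; [Hm1 n p] is H_(p-1), the factor
   accumulated by then. *)
suff H p : (p <= m)%N -> wnorm2 alpha (iter m (@Lap R n) u) =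
    Hm1 n p alpha * wnorm2 (alpha + 4 * p%:R) (iter (m - p) (@Lap R n) u)
    + \sum_(1 <= k < p.+1) F k.
  by rewrite (H m (leqnn m)) subnn.
elim: p => [_|p IH pm].
  by rewrite big_geq // /Hm1 big_ord0 mul1r mulr0 !addr0 subn0.
rewrite (IH (ltnW pm)) [in RHS]big_nat_recr //= [RHS]addrCA [LHS]addrC; congr (_ + _).
(* The m - p - 1 remaining Laplacians use 2 (m - p - 1) derivatives, so at least two are left. *)
have cf : Ckann rho M 2 (iter (m - p.+1) (@Lap R n) u).
  apply: Ckann_iter_Lap; apply: Ckann_leq cU.
  by rewrite -mulnSr leq_mul2l /= -subSn // subSS leq_subr.
have -> : iter (m - p) (@Lap R n) u = Lap (iter (m - p.+1) (@Lap R n) u).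
  by rewrite -iterS -subSn // subSS.
rewrite (Rellich_identity rho0 M0 _ cf) /F /=.
have e1 : alpha + 4 * p.+1%:R - 4 = alpha + 4 * p%:R by rewrite -natr1; ring.
have e2 : alpha + 4 * p.+1%:R - 2 = alpha + 4 * p%:R + 2 by rewrite -natr1; ring.
have e3 : alpha + 4 * p.+1%:R = alpha + 4 * p%:R + 4 by rewrite -natr1; ring.
rewrite e1 e2 e3 [Hm1 n p.+1 alpha]/Hm1 big_ord_recr /= -/(Hm1 n p alpha).
by ring.
Qed.
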